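(* Let $F$ be a limit fractal with spectral triple $(\mathcal A,\mathcal H,D)$, let $s$ be a singular traceability exponent for $|D|^{-1}$, and let $\tau_\omega$ be a corresponding singular trace, normalized by $\tau_\omega(|D|^{-s})=1$. Then, for any continuous function $f$ on $F$, $$\tau_\omega(f|D|^{-s})=\int_Ff\,d\mu_s,$$ where $\mu_s$ is the probability measure on $F$ homogeneous of order $s$ with respect to the generating symmetries of $F$. In particular continuous functions are measurable, i.e. the value $\tau_\omega(f|D|^{-s})$ does not depend on the generalized limit procedure $\omega$.
   Context: Limit fractal: let $a<b$ and, for each $n\ge1$, let $w_{n1},\dots,w_{np_n}$ be contracting similarities of $\mathbb R$ with dilation parameters $\lambda_{ni}\in(0,1)$ such that (1) $w_{ni}([a,b])\subset[a,b]$; (2) $w_{ni}([a,b])\cap w_{nj}([a,b])=\emptyset$ for $i\ne j$; (3) $\bigcup_iw_{ni}(\{a,b\})\supset\{a,b\}$. Put $w_n(\Omega)=\bigcup_{i=1}^{p_n}w_{ni}(\Omega)$ and $F=\bigcap_n w_1\circ\cdots\circ w_n([a,b])$. $F$ is required to be a fractal in $\mathbb R$, i.e. compact, totally disconnected and without isolated points; such $F$ is a limit fractal. For a multi-index $\sigma=(\sigma(1),\dots,\sigma(n))$, $1\le\sigma(j)\le p_j$, of length $|\sigma|=n$, $w_\sigma=w_{1\sigma(1)}\circ\cdots\circ w_{n\sigma(n)}$. With $F_n=\bigcap_{k\ge1}w_{n+1}\circ\cdots\circ w_{n+k}([a,b])$ one has the disjoint union $F=\bigcup_{|\sigma|=n}w_\sigma(F_n)$.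 The generating symmetries are the similarities $w_{\sigma'}\circ w_\sigma^{-1}:w_\sigma(F_n)\to w_{\sigma'}(F_n)$, $|\sigma|=|\sigma'|=n$, $n\ge1$. A measure $\mu$ on $F$ is homogeneous of order $\alpha>0$ w.r.t. the generating symmetries if for every generating symmetry $T$ with scaling parameter $\lambda$ and every relatively open subset $\Omega$ of the domain of $T$ (equivalently, for $\Omega$ equal to the domain of $T$, for all $T$), $\mu(T(\Omega))=\lambda^\alpha\mu(\Omega)$. $\mu_\alpha$ is the unique probability measure on $F$ homogeneous of order $\alpha$; it is determined by $\mu_\alpha(w_\sigma(F_n))=\lambda_\sigma^\alpha\big/\sum_{|\sigma'|=n}\lambda_{\sigma'}^\alpha$, $|\sigma|=n$, with $\lambda_\sigma=\prod_j\lambda_{j\sigma(j)}$. Spectral triple: for a bounded interval $I$ let $\mathcal H(I)=\ell^2(\partial I)$, $D(I)=\frac1{|I|}\begin{pmatrix}0&1\\1&0\end{pmatrix}$. Let $I_1,I_2,\dots$ be the lacunae of $F$ (connected components of $[a,b]\setminus F$), $\mathcal H_\ell=\bigoplus_k\mathcal H(I_k)$, $D_\ell=\bigoplus_kD(I_k)$; let $\mathcal F_n=\{w_\sigma([a,b]):|\sigma|=n\}$ (with $\mathcal F_0=\{[a,b]\}$), $\mathcal H_f=\bigoplus_{n,\,I\in\mathcal F_n}\mathcal H(I)$, $D_f=\bigoplus_{n,\,I\in\mathcal F_n}D(I)$. Then $\mathcal H=\mathcal H_\ell\oplus\mathcal H_f$, $D=D_\ell\oplus D_f$, and $\mathcal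 A=\mathrm{Lip}(F)$; functions on $F$ act by pointwise multiplication. A singular trace on $\mathcal B(\mathcal H)$ is a positive tracial weight $\tau:\mathcal B(\mathcal H)_+\to[0,\infty]$ vanishing on finite rank projections, extended linearly to its domain. $s>0$ is a singular traceability exponent for $|D|^{-1}$ if some singular trace is finite and nonzero on $|D|^{-s}$. *)

(* Defs.v *)
From HB Require Import structures.
From mathcomp Require Import all_boot all_order all_algebra.
From mathcomp Require Import complex.
From mathcomp Require Import ring.
From mathcomp Require Import all_classical all_reals all_analysis.

Set Implicit Arguments.
Unset Strict Implicit.
Unset Printing Implicit Defensive.

Import Order.TTheory GRing.Theory Num.Theory.
Import numFieldNormedType.Exports.
Import ComplexField.Normc.

Local Open Scope classical_set_scope.
Local Open Scope ring_scope.

Section Ell2.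
Variables (R : realType) (J : choiceType).
Local Notation C := (R[i]^o).

Definition square_summable (x : J -> C) : bool :=
  (\esum_(j in [set: J]) (normc (x j) ^+ 2)%:E < +oo)%E.

Lemma esum_lty_le (k : R) (a b : J -> R) :
  0 <= k -> (forall j, 0 <= a j) -> (forall j, b j <= k * a j) ->
  (\esum_(j in [set: J]) (a j)%:E < +oo)%E ->
  (\esum_(j in [set: J]) (b j)%:E < +oo)%E.
Proof.
move=> k0 a0 bka afin.
apply: (@le_lt_trans _ _ (k%:E * \esum_(j in [set: J]) (a j)%:E)%E); last first.
  have e0 : (0 <= \esum_(j in [set: J]) (a j)%:E)%E.
    by apply: esum_ge0 => j _; rewrite lee_fin.
  by rewrite lte_mul_pinfty// lee_fin.
apply: ge_ereal_sup => _ [A [finA _]] <-.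
apply: (@le_trans _ _ (\sum_(j \in A) k%:E * (a j)%:E)%E).
  by apply: lee_fsum => // j _; rewrite -EFinM lee_fin.
rewrite -ge0_mule_fsumr; last by move=> j; rewrite lee_fin.
apply: lee_wpmul2l; first by rewrite lee_fin.
by apply: esum_ge; exists A.
Qed.

Lemma square_summable_submod_closed : submod_closed square_summable.
Proof.
split=> [|c x y].
  by rewrite unfold_in /square_summable esum1 ?ltry// => j _;
    rewrite normc0 expr0n.
rewrite !unfold_in /square_summable => hx hy.
pose k : R := 2 * (normc c ^+ 2 + 1).
have normc_ge0 (z : R[i]) : 0 <= normc z by case: z => u v; exact: sqrtr_ge0.
apply: (@esum_lty_le k (fun j => normc (x j) ^+ 2 + normc (y j) ^+ 2)).
- by rewrite mulr_ge0// addr_ge0 ?sqr_ge0.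
- by move=> j; rewrite addr_ge0// sqr_ge0.
- move=> j; have /= := le_normcD (c * x j) (y j); rewrite normcM.
  set u := normc c; set v := normc (x j); set w := normc (y j) => le1.
  have le2 : normc ((c *: x + y) j) ^+ 2 <= (u * v + w) ^+ 2.
    by rewrite lerXn2r// nnegrE ?addr_ge0 ?mulr_ge0 ?normc_ge0.
  apply: (le_trans le2); rewrite /k -/u -subr_ge0.
  have -> : 2 * (u ^+ 2 + 1) * (v ^+ 2 + w ^+ 2) - (u * v + w) ^+ 2
     = (u * v - w) ^+ 2 + 2 * v ^+ 2 + 2 * u ^+ 2 * w ^+ 2 by ring.
  by do ?[exact: sqr_ge0 | exact: ler0n | apply: addr_ge0 | apply: mulr_ge0].
under eq_esum do rewrite EFinD.
by rewrite esumD ?lte_add_pinfty// => j _; rewrite lee_fin sqr_ge0.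
Qed.

HB.instance Definition _ :=
  GRing.isSubmodClosed.Build R[i] (J -> C) square_summable
    square_summable_submod_closed.

Record ell2 := Ell2 {
  ell2_val :> J -> C;
  ell2P : square_summable ell2_val }.

HB.instance Definition _ := [isSub for ell2_val].
HB.instance Definition _ := [Choice of ell2 by <:].
HB.instance Definition _ := [SubChoice_isSubLmodule of ell2 by <:].
End Ell2.

Section Operators.
Variables (R : realType) (J : choiceType).
Local Notation C := (R[i]^o).
Local Notation H := (ell2 R J).
Implicit Types (x y : H) (A B T P : H -> H) (tau : (H -> H) -> \bar R).

(* Sum of an absolutely convergent family. *)
Definition sum_real (u : J -> R) : R :=
  fine (\esum_(j in [set: J]) (Num.max (u j) 0)%:E) -
  fine (\esum_(j in [set: J]) (Num.max (- u j) 0)%:E).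

Definition sum_complex (u : J -> C) : R[i] :=
  (sum_real (fun j => complex.Re (u j)) +i*
   sum_real (fun j => complex.Im (u j)))%C.

(* Antilinear in the first argument. *)
Definition inner x y : R[i] := sum_complex (fun j => (x j)^* * y j).

Definition ell2_norm x : R :=
  Num.sqrt (fine (\esum_(j in [set: J]) (normc (x j) ^+ 2)%:E)).

Definition bounded_operator T :=
  (forall (c : R[i]) x y, T (c *: x + y) = c *: T x + T y) /\
  (exists M : R, forall x, ell2_norm (T x) <= M * ell2_norm x).

(* The order of R[i] makes [0 <= z] mean that z is real and nonnegative. *)
Definition positive_operator T :=
  bounded_operator T /\ forall x, 0 <= inner x (T x).

Definition adjoint_of A B := forall x y, inner (A x) y = inner x (B y).

Definition finite_rank T :=
  exists (n : nat) (v : 'I_n -> H),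
    forall x, exists c : 'I_n -> R[i], T x = \sum_(k < n) c k *: v k.

Definition orthogonal_projection P :=
  [/\ bounded_operator P, adjoint_of P P & forall x, P (P x) = P x].

(* A weight is a map B(H)_+ -> [0, +oo]; the values of [tau] off the positive
   bounded operators are irrelevant. Note that 0 * +oo = 0. *)
Record tracial_weight tau : Prop := {
  weight_ge0 : forall T, positive_operator T -> (0 <= tau T)%E;
  weightD : forall A B, positive_operator A -> positive_operator B ->
    tau (fun x => A x + B x) = (tau A + tau B)%E;
  weightZ : forall (c : R) T, 0 <= c -> positive_operator T ->
    tau (fun x => c%:C%C *: T x) = (c%:E * tau T)%E;
  weight_tracial : forall A B, bounded_operator A -> bounded_operator B ->
    adjoint_of A B -> tau (B \o A) = tau (A \o B) }.

Definition singular_trace tau :=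
  tracial_weight tau /\
  forall P, orthogonal_projection P -> finite_rank P -> tau P = 0%E.

(* Linear extension of [tau] to the span of the positive operators on which it
   is finite: T = Q_0 + i Q_1 - Q_2 - i Q_3. *)
Definition trace_decomposition tau T (Q : 'I_4 -> H -> H) :=
  (forall k, positive_operator (Q k) /\ (tau (Q k) < +oo)%E) /\
  (forall x, T x = \sum_(k < 4) 'i%C ^+ k *: Q k x).

Definition trace_domain tau T := exists Q, trace_decomposition tau T Q.

Definition trace_ext tau T : R[i] :=
  xget 0 [set z | exists2 Q, trace_decomposition tau T Q &
                  z = \sum_(k < 4) 'i%C ^+ k * (fine (tau (Q k)))%:C%C].

(* The bounded function g(D) of a diagonalizable self-adjoint operator D, given
   by its action on families: g(D) multiplies by g(l) every eigenvector of D in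
   l^2(J) with eigenvalue l. *)
Definition functional_calculus (D : (J -> C) -> (J -> C)) (g : R -> R) T :=
  bounded_operator T /\
  forall (l : R) x, (forall j, D x j = l%:C%C * x j) -> T x = (g l)%:C%C *: x.

(* |D|^-s *)
Definition abs_pow (D : (J -> C) -> (J -> C)) (s : R) : H -> H :=
  xget (fun=> 0) (functional_calculus D (fun l => `|l| `^ (- s))).

(* [s] is a singular traceability exponent for |D|^-1. *)
Definition singular_traceability_exponent (D : (J -> C) -> (J -> C)) (s : R) :=
  0 < s /\ exists tau, singular_trace tau /\ (0 < tau (abs_pow D s) < +oo)%E.

(* Multiplication by [g]; the default value 0 only serves families that leave
   l^2(J), which does not happen for bounded [g]. *)
Definition multiplication (g : J -> C) : H -> H :=
  fun x => insubd 0 (fun j => g j * x j).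

End Operators.

Section Fractal.
Variable R : realType.

(* The index n : nat stands for the level n + 1, and i : 'I_(p n) for i + 1. *)
Record similarity_system := SimilaritySystem {
  left_end : R;
  right_end : R;
  arity : nat -> nat;
  wmap : forall n, 'I_(arity n) -> R -> R;
  dilation : forall n, 'I_(arity n) -> R }.

Variable X : similarity_system.
Local Notation a := (left_end X).
Local Notation b := (right_end X).
Local Notation p := (arity X).
Local Notation w := (@wmap X _).
Local Notation lambda := (@dilation X _).

Definition wimage (n : nat) (A : set R) : set R :=
  \bigcup_(i in [set: 'I_(p n)]) (w i @` A).

(* w_(n+1) o ... o w_(n+k) as a map on sets *)
Definition wimages (n k : nat) : set R -> set R :=
  \big[comp/id]_(n <= m < n + k) wimage m.

Definition tail_fractal (n : nat) : set R :=
  \bigcap_(k in [set k | (1 <= k)%N]) wimages n k `[a, b].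

Definition fractal : set R := tail_fractal 0.

Record limit_fractal : Prop := {
  ends_lt : a < b;
  dilation_itv : forall n (i : 'I_(p n)), 0 < lambda i < 1;
  wmap_similarity : forall n (i : 'I_(p n)) x y,
    `|w i x - w i y| = lambda i * `|x - y|;
  wmap_sub : forall n (i : 'I_(p n)), w i @` `[a, b] `<=` `[a, b];
  wmap_disjoint : forall n (i j : 'I_(p n)), i != j ->
    (w i @` `[a, b]) `&` (w j @` `[a, b]) = set0;
  wmap_ends : forall n,
    [set a; b] `<=` \bigcup_(i in [set: 'I_(p n)]) (w i @` [set a; b]);
  fractal_compact : compact fractal;
  fractal_disconnected : totally_disconnected fractal;
  fractal_perfect : isolated fractal = set0 }.

Definition multi_index (n : nat) := forall j : 'I_n, 'I_(p j).

Definition wword n (sigma : multi_index n) : R -> R :=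
  \big[comp/id]_(j < n) w (sigma j).

Definition lambdaword n (sigma : multi_index n) : R :=
  \prod_(j < n) lambda (sigma j).

Definition cylinder n (sigma : multi_index n) : set R :=
  wword sigma @` tail_fractal n.

(* [T : R -> R] restricts to the generating symmetry
   w_sigma' o w_sigma^-1 : w_sigma(F_n) -> w_sigma'(F_n). *)
Definition generating_symmetry n (sigma sigma' : multi_index n) (T : R -> R) :=
  forall x, tail_fractal n x -> T (wword sigma x) = wword sigma' x.

(* Relatively open subsets of the domain are U `&` w_sigma(F_n), U open in R. *)
Definition homogeneous (alpha : R)
    (mu : {measure set (measurableTypeR R) -> \bar R}) :=
  forall n (sigma sigma' : multi_index n) (T : R -> R), (1 <= n)%N ->
    generating_symmetry sigma sigma' T ->
    forall U : set R, open U ->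
      (mu (T @` (U `&` cylinder sigma)) =
       ((lambdaword sigma' / lambdaword sigma) `^ alpha)%:E *
         mu (U `&` cylinder sigma))%E.

Definition lacuna : set (set R) :=
  [set I | exists2 x, (`[a, b] `\` fractal) x &
           I = connected_component (`[a, b] `\` fractal) x].

(* Pairs (n, I) with I = w_sigma([a, b]), |sigma| = n. *)
Definition filled : set (nat * set R) :=
  [set nI | exists sigma : multi_index nI.1, nI.2 = wword sigma @` `[a, b]].

Definition interval_index : Type := (set_type lacuna + set_type filled)%type.
HB.instance Definition _ := Choice.on interval_index.

Definition interval_of (k : interval_index) : set R :=
  match k with inl u => val u | inr u => (val u).2 end.

Definition interval_length (I : set R) : R := sup I - inf I.

(* The basis of H is indexed by the pairs (I, e), with e = false (true) for the
   left (right) endpoint of I. *)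
Definition triple_basis : Type := (interval_index * bool)%type.
HB.instance Definition _ := Choice.on triple_basis.

Definition endpoint (j : triple_basis) : R :=
  if j.2 then sup (interval_of j.1) else inf (interval_of j.1).

(* On the block of I this is |I|^-1 times the matrix with rows (0 1), (1 0). As
   an operator of l^2, D is unbounded: its domain consists of the x in l^2 whose
   image is again in l^2. *)
Definition dirac_operator (x : triple_basis -> R[i]^o) :
    triple_basis -> R[i]^o :=
  fun j => ((interval_length (interval_of j.1))^-1)%:C%C * x (j.1, ~~ j.2).

Definition function_operator (f : R -> R[i]^o) :
    ell2 R triple_basis -> ell2 R triple_basis :=
  multiplication (fun j => f (endpoint j)).

End Fractal.

Arguments dirac_operator {R} X x.
Arguments homogeneous {R} X alpha mu.

(* Main.v *)
(** The operator |D|^-s multiplies the basis vectors of the block of an interval I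
    by |I|^s, so that f |D|^-s is diagonal. A generating symmetry between two
    cells w_s(F_n), w_t(F_n) carries all but finitely many of the lacunae and
    filled intervals touching the first cell onto those touching the second one
    and rescales their lengths; the permutation of the basis exchanging them is
    unitary. Hence a singular trace, which ignores finitely many blocks, gives the
    cells of level n masses proportional to lambda_sigma^s, exactly as the
    homogeneous measure does. Since F contains no interval, the cells shrink
    uniformly, and both functionals are limits of the same Riemann sums. *)

Require Import Defs.
From mathcomp Require Import all_boot all_order all_algebra.
From mathcomp Require Import complex ring lra.
From mathcomp Require Import all_classical all_reals all_analysis.
From mathcomp Require Import measurable_realfun.

Set Implicit Arguments.
Unset Strict Implicit.
Unset Printing Implicit Defensive.

Import Order.TTheory GRing.Theory Num.Theory.
Import numFieldNormedType.Exports.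
Import ComplexField.Normc.

Local Open Scope classical_set_scope.
Local Open Scope ring_scope.

(** * Operators on l^2 *)

(** The dilation parameters are not assumed to stay away from 1, so no contraction estimate makes
    the cells small; their size is controlled through gaps of [F] on a finite grid. The tracial
    property concerns products of mutually adjoint operators, so the permutation of the basis enters
    through a weighted composition with an involution; two distinct cells of one level are disjoint,
    and an involution can exchange them. Similarities may reverse orientation and do not act on the
    index type of the basis. Each basis vector is therefore coded by its kind, its own endpoint and
    the opposite one, and the similarities act on these codes. A trace is additive on positive
    operators only, and its value on [f |D|^-s] is picked by choice among the values given by
    decompositions into four positive operators. Independence of the decomposition is a separate
    polarization argument, and a continuous function is handled through the positive and negative
    parts of its real and imaginary parts. *)

Section Ell2Theory.
Variables (R : realType) (J : choiceType).
Local Notation C := (R[i]^o).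
Local Notation H := (ell2 R J).
Implicit Types (x y : H) (g h : J -> C) (phi : J -> J) (A B : H -> H).

Lemma normc_ge0 (z : R[i]) : 0 <= normc z.
Proof. by case: z => u v; exact: sqrtr_ge0. Qed.

Lemma normc_real (r : R) : normc r%:C%C = `|r|.
Proof. by rewrite /= expr0n addr0 sqrtr_sqr. Qed.

Lemma maxr0_sub (r : R) : Num.max r 0 - Num.max (- r) 0 = r.
Proof.
case: (lerP 0 r) => r0; first by rewrite max_r ?oppr_le0 ?subr0.
by rewrite max_l ?sub0r ?opprK// oppr_ge0 ltW.
Qed.

Definition sqnorm (x : J -> C) : \bar R :=
  \esum_(j in [set: J]) (normc (x j) ^+ 2)%:E.

Lemma sqnorm_ge0 (x : J -> C) : (0 <= sqnorm x)%E.
Proof. by apply: esum_ge0 => j _; rewrite lee_fin sqr_ge0. Qed.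

Lemma sqnorm_fin_num x : sqnorm x \is a fin_num.
Proof. by rewrite ge0_fin_numE ?sqnorm_ge0//; exact: (ell2P x). Qed.

Lemma le_sqnorm (k : R) (x y : J -> C) :
  (forall j, normc (x j) <= k * normc (y j)) ->
  (sqnorm x <= (k ^+ 2)%:E * sqnorm y)%E.
Proof.
move=> xy; apply: ge_ereal_sup => _ [A [finA _]] <-.
apply: (@le_trans _ _ (\sum_(j \in A) (k ^+ 2)%:E * (normc (y j) ^+ 2)%:E)%E).
  apply: lee_fsum => // j _; rewrite -EFinM lee_fin -exprMn.
  by rewrite lerXn2r// nnegrE ?normc_ge0// (le_trans _ (xy j)) ?normc_ge0.
rewrite -ge0_mule_fsumr; last by move=> j; rewrite lee_fin sqr_ge0.
apply: lee_wpmul2l; first by rewrite lee_fin sqr_ge0.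
by apply: esum_ge; exists A.
Qed.

Lemma sqnorm_involutive phi (x : J -> C) :
  involutive phi -> sqnorm (x \o phi) = sqnorm x.
Proof.
move=> phiK; symmetry; apply: (@reindex_esum R J J setT setT phi).
split=> //; first by move=> i j _ _; exact: (can_inj phiK).
by move=> j _; exists (phi j).
Qed.

Lemma normc_le_ell2_norm x j : normc (x j) <= ell2_norm x.
Proof.
rewrite -[leLHS]ger0_norm ?normc_ge0// -sqrtr_sqr ler_wsqrtr//.
rewrite -lee_fin fineK ?sqnorm_fin_num//.
apply: esum_ge; exists [set j] => //; rewrite fsbig_set1//.
Qed.

Lemma ell2_eqP x y : (forall j, x j = y j) -> x = y.
Proof. by move=> xy; apply: val_inj; apply/funext => j; exact: xy. Qed.

Lemma ell2_addE x y j : (x + y) j = x j + y j. Proof. by []. Qed.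

Lemma ell2_scaleE (c : R[i]) x j : (c *: x) j = c * x j. Proof. by []. Qed.

Lemma ell2_subE x y j : (x - y) j = x j - y j. Proof. by []. Qed.

Lemma ell2_sumE (I : Type) (r : seq I) (P : pred I) (F : I -> H) j :
  (\sum_(i <- r | P i) F i) j = \sum_(i <- r | P i) F i j.
Proof. by elim/big_rec2: _ => // i u v _ <-. Qed.

Lemma ell2_linear0 A : (forall (c : R[i]) x y, A (c *: x + y) = c *: A x + A y) ->
  A 0 = 0.
Proof.
by move=> Al; apply: (addIr (A 0)); rewrite -{1}(scale1r (A 0)) -Al scaler0 !add0r.
Qed.

(** Multiplications are the case [phi = id], so one boundedness argument serves them and the
    permutations of the basis. The default 0 of [insubd] does not occur for bounded [h] and
    involutive [phi], by [wcompE]. *)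
Definition wcomp h phi (x : H) : H := insubd 0 (fun j => h j * x (phi j)).

Section WeightedComposition.
Variables (h : J -> C) (phi : J -> J) (k : R).
Hypothesis hk : forall j, normc (h j) <= k.
Hypothesis phiK : involutive phi.

Lemma le_sqnorm_wcomp x :
  (sqnorm (fun j => (h j * x (phi j))%R) <= (k ^+ 2)%:E * sqnorm x)%E.
Proof.
rewrite -(sqnorm_involutive x phiK); apply: le_sqnorm => j /=.
by rewrite normcM ler_wpM2r ?normc_ge0.
Qed.

Lemma wcompE x j : wcomp h phi x j = h j * x (phi j).
Proof.
rewrite /wcomp insubdK//; apply: (le_lt_trans (le_sqnorm_wcomp x)).
by rewrite lte_mul_pinfty ?lee_fin ?sqr_ge0//; exact: (ell2P x).
Qed.

Lemma bounded_wcomp : bounded_operator (wcomp h phi).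
Proof.
split=> [c x y|].
  apply: ell2_eqP => j; rewrite wcompE.
  by rewrite ell2_addE ell2_scaleE ell2_addE ell2_scaleE !wcompE mulrDr mulrCA.
exists `|k| => x; rewrite -sqrtr_sqr -sqrtrM ?sqr_ge0// ler_wsqrtr//.
rewrite -lee_fin EFinM !fineK ?sqnorm_fin_num//.
rewrite [leLHS](_ : _ = sqnorm (fun j => h j * x (phi j))) ?le_sqnorm_wcomp//.
by apply: eq_esum => j _; rewrite wcompE.
Qed.

End WeightedComposition.

Lemma mulmE (g : J -> C) (k : R) : (forall j, normc (g j) <= k) ->
  forall x j, multiplication g x j = g j * x j.
Proof. by move=> gk x j; exact: (@wcompE g id k gk). Qed.

Lemma bounded_multiplication (g : J -> C) (k : R) :
  (forall j, normc (g j) <= k) -> bounded_operator (multiplication g).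
Proof. by move=> gk; exact: (@bounded_wcomp g id k gk). Qed.

Lemma square_summable_basis (i : J) :
  square_summable (fun j => (j == i)%:R : C).
Proof.
rewrite /square_summable.
rewrite [X in (X < _)%E](_ : _ = (\esum_(j in [set i]) 1%:E)%E); last first.
  rewrite [RHS]esum_mkcond; apply: eq_esum => j _.
  have [->|/eqP ji] := eqVneq j i; first by rewrite mem_set// normc1 expr1n.
  by rewrite memNset// normc0 expr0n.
by rewrite esum_set1 ?lee_fin// ltry.
Qed.

Definition basis_vector (i : J) : H := Ell2 (square_summable_basis i).

End Ell2Theory.

(** * Density of finite combinations of basis vectors *)

Section Density.
Variables (R : realType) (J : choiceType).
Local Notation C := (R[i]^o).
Local Notation H := (ell2 R J).
Implicit Types (x y : H) (A B : H -> H).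

(** A finite set [S] nearly attains the supremum that defines [sqnorm x]; what remains is the sum
    over the complement of [S], which is the square norm of the difference. *)
Lemma sqnorm_tail x (e : R) : 0 < e -> exists2 s : seq J, uniq s &
  (sqnorm (x - \sum_(i <- s) x i *: basis_vector R i)%R <= e%:E)%E.
Proof.
move=> e0; have xfin := sqnorm_fin_num x.
have [_ [S [finS _] <-] Se] := ub_ereal_sup_adherent e0 xfin.
exists (finmap.enum_fset (fset_set S)); first exact: finmap.fset_uniq.
set s := finmap.enum_fset _.
have sS j : (j \in s) = (j \in S) by rewrite /s -in_fset_set.
have tailE j : (x - \sum_(i <- s) x i *: basis_vector R i) j =
    if j \in S then 0 else x j.
  have -> : (x - \sum_(i <- s) x i *: basis_vector R i) j =
      x j - \sum_(i <- s) x i * (j == i)%:R.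
    by rewrite ell2_subE ell2_sumE.
  rewrite -sS; case: ifP => js.
    rewrite (bigD1_seq j)//= ?finmap.fset_uniq// eqxx mulr1 big1 ?addr0 ?subrr//.
    by move=> i ij; rewrite eq_sym (negbTE ij) mulr0.
  rewrite big_seq big1 ?subr0// => i si; have [ji|_] := eqVneq j i; last by rewrite mulr0.
  by move: js; rewrite ji si.
have nn (j : J) : [set: J] j -> (0 <= (normc (x j) ^+ 2)%:E)%E.
  by move=> _; rewrite lee_fin sqr_ge0.
have : (sqnorm x < esum S (fun j => (normc (x j) ^+ 2)%:E) + e%:E)%E.
  rewrite -lteBlDr//; apply: (lt_le_trans Se).
  by rewrite esum_fset// => i _; rewrite lee_fin sqr_ge0.
rewrite {1}/sqnorm (esumID S)// !setTI lteD2lE; last first.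
  rewrite esum_fset// ?fsbig_finite//= ?sumEFin// => i _.
  by rewrite lee_fin sqr_ge0.
move=> /ltW; apply: le_trans; rewrite [leRHS]esum_mkcond; apply: le_esum => j _.
rewrite tailE in_setC.
by case: (j \in S) => //=; rewrite !(expr0n, addr0, sqrtr0).
Qed.

(** Bounds on single coordinates suffice, and they pass to sums of operators by the triangle
    inequality for complex numbers, without Minkowski's inequality in l^2. *)
Lemma linear_entrywise_ext A B (MA MB : R) :
  (forall (c : R[i]) x y, A (c *: x + y) = c *: A x + A y) ->
  (forall (c : R[i]) x y, B (c *: x + y) = c *: B x + B y) ->
  (forall x j, normc (A x j) <= MA * ell2_norm x) ->
  (forall x j, normc (B x j) <= MB * ell2_norm x) ->
  (forall i, A (basis_vector R i) = B (basis_vector R i)) -> A = B.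
Proof.
move=> Al Bl hA hB AB; apply/funext => x; apply: ell2_eqP => j.
have ABs s : A (\sum_(i <- s) x i *: basis_vector R i) =
    B (\sum_(i <- s) x i *: basis_vector R i).
  elim: s => [|i s IH]; first by rewrite !big_nil !ell2_linear0.
  by rewrite !big_cons Al Bl IH AB.
apply/eqP; rewrite -subr_eq0; apply/eqP/eq0_normc.
apply/eqP; rewrite eq_le normc_ge0 andbT.
suff small (e : R) : 0 < e -> normc (A x j - B x j) <= e.
  by apply/ler_addgt0Pl => e e0; rewrite addr0; exact: small.
move=> e0; pose M : R := `|MA| + `|MB| + 1.
have M0 : 0 < M by rewrite /M ltr_wpDl// addr_ge0.
have [s us xs] := sqnorm_tail x (exprn_gt0 2 (divr_gt0 e0 M0)).
set r := x - _ in xs.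
have -> : A x j - B x j = A r j - B r j.
  have xE : x = r + \sum_(i <- s) x i *: basis_vector R i by rewrite subrK.
  by rewrite xE addrC -(scale1r r) addrC Al Bl !ell2_addE !scale1r ABs opprD addrACA subrr addr0.
have rM : ell2_norm r <= e / M.
  have eM : 0 <= e / M by rewrite divr_ge0 ?ltW.
  rewrite -[leRHS](ger0_norm eM) -sqrtr_sqr. rewrite ler_wsqrtr//.
  by rewrite -lee_fin fineK ?sqnorm_fin_num.
have r0 : 0 <= ell2_norm r by exact: sqrtr_ge0.
have := le_normcD (A r j) (- B r j); rewrite normcN => /le_trans; apply.
have := hA r j; have := hB r j.
have le1 : MA * ell2_norm r <= `|MA| * ell2_norm r by rewrite ler_wpM2r ?ler_norm.
have le2 : MB * ell2_norm r <= `|MB| * ell2_norm r by rewrite ler_wpM2r ?ler_norm.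
have le3 : M * ell2_norm r <= e by rewrite mulrC -ler_pdivlMr.
rewrite /M in le3; lra.
Qed.

Lemma bounded_operator_entry A : bounded_operator A ->
  exists M : R, forall x j, normc (A x j) <= M * ell2_norm x.
Proof.
move=> [_ [M hM]]; exists M => x j.
exact: le_trans (normc_le_ell2_norm _ _) (hM x).
Qed.

Lemma bounded_operator_ext A B : bounded_operator A -> bounded_operator B ->
  (forall i, A (basis_vector R i) = B (basis_vector R i)) -> A = B.
Proof.
move=> bA bB AB; have [[MA hA] [MB hB]] :=
  (bounded_operator_entry bA, bounded_operator_entry bB).
exact: linear_entrywise_ext bA.1 bB.1 hA hB AB.
Qed.

End Density.

(** * Inner products and positive multiplication operators *)

Section Positivity.
Variables (R : realType) (J : choiceType).
Local Notation C := (R[i]^o).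
Local Notation H := (ell2 R J).
Implicit Types (x y : H) (A B T : H -> H).

Lemma eq_sum_complex (u v : J -> C) : u =1 v -> sum_complex u = sum_complex v.
Proof. by move=> /funext ->. Qed.

Lemma esum_seq (v : J -> R) (s : seq J) : uniq s -> (forall j, 0 <= v j) ->
  (forall j, j \notin s -> v j = 0) ->
  fine (\esum_(j in [set: J]) (v j)%:E)%E = \sum_(j <- s) v j.
Proof.
move=> us v0 vs.
rewrite [X in fine X](_ : _ = (\esum_(j in [set` s]) (v j)%:E)%E); last first.
  rewrite [RHS]esum_mkcond; apply: eq_esum => j _.
  have [js|js] := boolP (j \in s); first by rewrite mem_set.
  by rewrite memNset ?vs//; apply/negP.
rewrite esum_fset//; last by move=> j _; rewrite lee_fin.
by rewrite -fsbig_seq// sumEFin.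
Qed.

Lemma sum_real_seq (u : J -> R) (s : seq J) : uniq s ->
  (forall j, j \notin s -> u j = 0) -> Defs.sum_real u = \sum_(j <- s) u j.
Proof.
move=> us u0; rewrite /Defs.sum_real !(@esum_seq _ s)//.
- by rewrite -sumrB; apply: eq_bigr => j _; rewrite maxr0_sub.
- by move=> j; rewrite le_max lexx orbT.
- by move=> j js; rewrite u0// oppr0 maxxx.
- by move=> j; rewrite le_max lexx orbT.
- by move=> j js; rewrite u0// maxxx.
Qed.

Lemma sum_complex_seq (u : J -> C) (s : seq J) : uniq s ->
  (forall j, j \notin s -> u j = 0) -> sum_complex u = \sum_(j <- s) u j.
Proof.
move=> us u0; rewrite /sum_complex !(@sum_real_seq _ s)//.
- by elim: (s) => [|j t IH]; rewrite ?big_nil// !big_cons -IH; case: (u j).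
- by move=> j /u0 ->.
- by move=> j /u0 ->.
Qed.

Lemma sum_complex_involutive (u : J -> C) (phi : J -> J) :
  involutive phi -> sum_complex (u \o phi) = sum_complex u.
Proof.
move=> phiK.
have bij : set_bij setT setT phi.
  split=> //; first by move=> i j _ _; exact: (can_inj phiK).
  by move=> j _; exists (phi j).
by rewrite /sum_complex /Defs.sum_real; congr (_ +i* _)%C; congr (fine _ - fine _);
  symmetry; apply: (reindex_esum _ _ _ _ bij).
Qed.

(** Reindexing the right-hand sum by [phi] makes the summands agree; the weights are real, so
    conjugation fixes them. *)
Lemma inner_adjoint_wcomp (h : J -> R) (phi : J -> J) (k : R) :
  (forall j, `|h j| <= k) -> involutive phi ->
  adjoint_of (wcomp (fun j => (h j)%:C%C) phi)
             (wcomp (fun j => (h (phi j))%:C%C) phi).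
Proof.
move=> hk phiK x y; rewrite /inner -[RHS](sum_complex_involutive _ phiK).
apply: eq_sum_complex => j /=.
have hk1 i : normc (h i)%:C%C <= k by rewrite normc_real.
have hk2 i : normc (h (phi i))%:C%C <= k by rewrite normc_real.
rewrite (wcompE hk1)// (wcompE hk2)// !phiK.
have -> : ((h j)%:C%C * x (phi j))^* = (h j)%:C%C * (x (phi j))^*.
  by rewrite rmorphM/=; congr (_ * _); exact: conjc_real.
by rewrite mulrAC mulrC.
Qed.

Definition real_mul (g : J -> R) : H -> H := multiplication (fun j => (g j)%:C%C).

Lemma real_mulE g k : (forall j, 0 <= g j <= k) ->
  forall x j, real_mul g x j = (g j)%:C%C * x j.
Proof.
move=> gk x j; rewrite /real_mul (@mulmE _ _ _ k)// => i.
by have /andP[g0 gi] := gk i; rewrite normc_real ger0_norm.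
Qed.

Lemma positive_real_mul g k : (forall j, 0 <= g j <= k) ->
  positive_operator (real_mul g).
Proof.
move=> gk; split.
  apply: (@bounded_multiplication _ _ _ k) => i.
  by have /andP[g0 gi] := gk i; rewrite normc_real ger0_norm.
move=> x; pose v j : R := g j * normc (x j) ^+ 2.
have v0 j : 0 <= v j by rewrite mulr_ge0 ?sqr_ge0//; case/andP: (gk j).
have -> : inner x (real_mul g x) = sum_complex (fun j => (v j)%:C%C).
  apply: eq_sum_complex => j; rewrite (real_mulE gk) mulrCA /v rmorphM/=.
  congr (_ * _); rewrite mulrC -normCK.
  by rewrite rmorphXn/=; congr (_ ^+ _); case: (x j).
have E0 : (\esum_(j in [set: J]) (Num.max (- 0 : R) 0)%:E)%E = 0%E.
  by rewrite esum1// => j _; rewrite oppr0 maxxx.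
have E1 : (\esum_(j in [set: J]) (Num.max (0 : R) 0)%:E)%E = 0%E.
  by rewrite esum1// => j _; rewrite maxxx.
rewrite /sum_complex lecE /= /Defs.sum_real E0 E1 subrr eqxx/=.
rewrite [X in _ - fine X](_ : _ = 0%E); last first.
  by apply: esum1 => j _; rewrite max_r// oppr_le0.
(* [fine] sends +oo to 0, so this real part is nonnegative whether or not the sum is finite. *)
rewrite subr0 fine_ge0//; apply: esum_ge0 => j _.
by rewrite lee_fin le_max lexx orbT.
Qed.

End Positivity.

(** * Traces of multiplication operators *)

Section TraceWeights.
Variables (R : realType) (J : choiceType).
Local Notation C := (R[i]^o).
Local Notation H := (ell2 R J).
Implicit Types (x y : H) (A B T : H -> H) (tau : (H -> H) -> \bar R)
  (g h : J -> R).

Definition nneg_bounded (k : R) g := forall j, 0 <= g j <= k.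

Lemma weight_real_mulD tau g h k : tracial_weight tau ->
  nneg_bounded k g -> nneg_bounded k h ->
  tau (real_mul (fun j => g j + h j)) = (tau (real_mul g) + tau (real_mul h))%E.
Proof.
move=> tw gk hk; rewrite -weightD//; try exact: positive_real_mul.
congr tau; apply/funext => x; apply: ell2_eqP => j.
rewrite ell2_addE (real_mulE gk) (real_mulE hk) (@real_mulE _ _ _ (k + k)).
  by rewrite rmorphD/= mulrDl.
by move=> i; have /andP[? ?] := gk i; have /andP[? ?] := hk i;
  rewrite addr_ge0//= lerD.
Qed.

Lemma weight_real_mulZ tau (c : R) g k : tracial_weight tau ->
  0 <= c -> nneg_bounded k g ->
  tau (real_mul (fun j => c * g j)) = (c%:E * tau (real_mul g))%E.
Proof.
move=> tw c0 gk; rewrite -weightZ//; last exact: positive_real_mul gk.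
congr tau; apply/funext => x; apply: ell2_eqP => j.
rewrite ell2_scaleE (real_mulE gk) (@real_mulE _ _ _ (c * k)).
  by rewrite rmorphM/= mulrA.
by move=> i; have /andP[? ?] := gk i; rewrite mulr_ge0//= ler_wpM2l.
Qed.

Lemma weight_real_mul_ge0 tau g k : tracial_weight tau -> nneg_bounded k g ->
  (0 <= tau (real_mul g))%E.
Proof. by move=> tw gk; apply: weight_ge0 => //; exact: positive_real_mul gk. Qed.

Lemma le_weight_real_mul tau g h k : tracial_weight tau ->
  nneg_bounded k g -> nneg_bounded k h -> (forall j, g j <= h j) ->
  (tau (real_mul g) <= tau (real_mul h))%E.
Proof.
move=> tw gk hk gh; pose d j := h j - g j.
have dk : nneg_bounded k d.
  move=> j; rewrite subr_ge0 gh/=; have /andP[g0 _] := gk j.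
  by have /andP[_ +] := hk j; apply: le_trans; rewrite gerBl.
have -> : h = (fun j => g j + d j) by apply/funext => j; rewrite addrC subrK.
by rewrite (weight_real_mulD tw gk dk) leeDl// (weight_real_mul_ge0 tw dk).
Qed.

(* With A x = sqrt g * (x o phi), A A^* and A^* A are the multiplications by
   g and by g o phi. *)
Lemma weight_real_mul_involutive tau g k (phi : J -> J) : tracial_weight tau ->
  nneg_bounded k g -> involutive phi ->
  tau (real_mul g) = tau (real_mul (g \o phi)).
Proof.
move=> tw gk phiK; pose h j := Num.sqrt (g j).
have g0 j : 0 <= g j by case/andP: (gk j).
have hk j : `|h j| <= Num.sqrt k.
  by rewrite ger0_norm ?sqrtr_ge0// ler_wsqrtr//; case/andP: (gk j).
have hk1 i : normc (h i)%:C%C <= Num.sqrt k by rewrite normc_real.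
have hk2 i : normc (h (phi i))%:C%C <= Num.sqrt k by rewrite normc_real.
have hh j : (h j)%:C%C * (h j)%:C%C = (g j)%:C%C :> R[i].
  by rewrite -rmorphM/= -expr2 sqr_sqrtr.
have gphik : nneg_bounded k (g \o phi) by move=> j; exact: gk.
pose A := wcomp (fun j => (h j)%:C%C) phi.
pose B := wcomp (fun j => (h (phi j))%:C%C) phi.
have BA : B \o A = real_mul (g \o phi).
  apply/funext => x; apply: ell2_eqP => j.
  by rewrite (real_mulE gphik) /= (wcompE hk2)// (wcompE hk1)// phiK mulrA hh.
have AB : A \o B = real_mul g.
  apply/funext => x; apply: ell2_eqP => j.
  by rewrite (real_mulE gk) /= (wcompE hk1)// (wcompE hk2)// !phiK mulrA hh.
rewrite -BA -AB; symmetry; apply: (weight_tracial tw).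
- exact: bounded_wcomp hk1 phiK.
- exact: bounded_wcomp hk2 phiK.
- exact: inner_adjoint_wcomp hk phiK.
Qed.

(** The operator is the rank-one projection onto the [i]-th basis vector. *)
Lemma singular_trace_delta tau i : singular_trace tau ->
  tau (real_mul (fun j => (j == i)%:R)) = 0%E.
Proof.
move=> [_]; apply.
  have b j : 0 <= ((j == i)%:R : R) <= 1 by case: eqP; rewrite /= ?lexx ?ler01.
  have b' j : `|(j == i)%:R : R| <= 1 by case: eqP; rewrite ?normr0 ?normr1.
  split; first exact: (positive_real_mul b).1.
    exact: (@inner_adjoint_wcomp _ _ _ id _ b').
  move=> x; apply: ell2_eqP => j; rewrite !(real_mulE b) mulrA -rmorphM/=.
  by rewrite -natrM mulnb andbb.
exists 1%N, (fun=> basis_vector R i) => x; exists (fun=> x i).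
have b j : 0 <= ((j == i)%:R : R) <= 1 by case: eqP; rewrite /= ?lexx ?ler01.
apply: ell2_eqP => j; rewrite (real_mulE b) big_ord1 ell2_scaleE /=.
by case: eqVneq => [->|_]; rewrite ?mulr1 ?mul1r// mulr0 mul0r.
Qed.

(** One index is split off at a time: its part of [g] is a multiple of a rank-one projection. *)
Lemma singular_trace_finite_support tau g k (s : seq J) : singular_trace tau ->
  nneg_bounded k g -> (forall j, j \notin s -> g j = 0) ->
  tau (real_mul g) = 0%E.
Proof.
move=> st; have tw := st.1; elim: s g => [|i s IH] g gk gs.
  (* Homogeneity with the factor 0 gives the trace 0, as 0 times any extended real is 0. *)
  have -> : g = (fun j => 0 * g j) by apply/funext => j; rewrite mul0r gs.
  by rewrite (weight_real_mulZ tw (lexx 0) gk) mul0e.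
have k0 : 0 <= k by have /andP[/le_trans] := gk i; apply.
pose g1 j := g i * (j == i)%:R; pose g2 j := g j * (j != i)%:R.
have g1k : nneg_bounded k g1.
  by move=> j; rewrite /g1; case: eqP; rewrite ?mulr1 ?mulr0 ?lexx.
have g2k : nneg_bounded k g2.
  by move=> j; rewrite /g2; case: eqP; rewrite /= ?mulr1 ?mulr0 ?lexx.
have -> : g = (fun j => g1 j + g2 j).
  apply/funext => j; rewrite /g1 /g2.
  by case: eqVneq => [->|_]; rewrite /= !(mulr1, mulr0, addr0, add0r).
rewrite (weight_real_mulD tw g1k g2k) (IH g2)//; last first.
  move=> j js; rewrite /g2; case: eqVneq => [->|ji]; first by rewrite mulr0.
  by rewrite gs ?mul0r// inE negb_or ji.
rewrite (@weight_real_mulZ _ _ _ 1)//.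
- by rewrite singular_trace_delta// mule0 adde0.
- by case/andP: (gk i).
- by move=> j; case: eqP; rewrite /= ?lexx ?ler01.
Qed.

End TraceWeights.

(** * The linear extension of a trace is well defined *)

Section TraceExtension.
Variables (R : realType) (J : choiceType).
Local Notation C := (R[i]^o).
Local Notation H := (ell2 R J).
Implicit Types (x y : H) (A B T : H -> H) (tau : (H -> H) -> \bar R).

Lemma inner_basis2 (c : R[i]) j k y :
  inner (basis_vector R j + c *: basis_vector R k) y = y j + c^* * y k.
Proof.
have xE i : (basis_vector R j + c *: basis_vector R k) i =
  (i == j)%:R + c * (i == k)%:R by [].
(* [undup] covers the case [j = k], where the support is a single index. *)
rewrite /inner (@sum_complex_seq _ _ _ (undup [:: j; k])) ?undup_uniq//; last first.
  move=> i; rewrite mem_undup !inE xE => /norP[/negbTE-> /negbTE->].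
  by rewrite mulr0 addr0 rmorph0 mul0r.
rewrite [undup _]/= inE; case: (eqVneq j k) xE => [->|jk] xE.
  by rewrite big_cons big_nil addr0 xE eqxx mulr1 rmorphD rmorph1 mulrDl mul1r.
rewrite !big_cons big_nil addr0 !xE !eqxx (negbTE jk) eq_sym (negbTE jk).
by rewrite mulr0 mulr1 addr0 add0r rmorph1 mul1r.
Qed.

(** Polarization on the vectors e_j + c e_k, for which inner products are finite sums: c = 0 yields
    the diagonal entries, c = 1 the sum of the entries (j, k) and (k, j), c = i their difference. *)
Lemma quadratic_form_ext A B (MA MB : R) :
  (forall (c : R[i]) x y, A (c *: x + y) = c *: A x + A y) ->
  (forall (c : R[i]) x y, B (c *: x + y) = c *: B x + B y) ->
  (forall x j, normc (A x j) <= MA * ell2_norm x) ->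
  (forall x j, normc (B x j) <= MB * ell2_norm x) ->
  (forall (c : R[i]) j k, let x := basis_vector R j + c *: basis_vector R k in
     inner x (A x) = inner x (B x)) -> A = B.
Proof.
move=> Al Bl hA hB q; apply: (linear_entrywise_ext Al Bl hA hB) => k.
apply: ell2_eqP => j; pose a i l : R[i] := A (basis_vector R l) i.
pose b i l : R[i] := B (basis_vector R l) i; rewrite -/(a j k) -/(b j k).
have key (c : R[i]) : c * a j k + a j j + c^* * (c * a k k + a k j) =
                      c * b j k + b j j + c^* * (c * b k k + b k j).
  by have := q c j k; rewrite /= !inner_basis2 [basis_vector R j + _]addrC Al Bl
    !ell2_addE !ell2_scaleE.
have diag l : a l l = b l l.
  have := q 0 l l; rewrite /= !inner_basis2 scale0r addr0.
  by rewrite conjC0 !mul0r !addr0.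
have k1 := key 1; rewrite conjC1 !mul1r !diag in k1.
have ki := key 'i%C.
have ci : ('i%C : R[i])^* = - 'i%C by apply/eqP; rewrite eq_complex /= oppr0 !eqxx.
rewrite ci !diag in ki.
have {}ki : 'i%C * (a j k - a k j) = 'i%C * (b j k - b k j) :> R[i].
  apply: (addIr (b j j + - 'i%C * ('i%C * b k k))).
  move: ki; set u := 'i%C; move=> ki.
  transitivity (u * a j k + b j j + - u * (u * b k k + a k j)); first by ring.
  by rewrite ki; ring.
have i0 : ('i%C : R[i]) != 0 by rewrite eq_complex /= oner_eq0 andbF.
move/(mulfI i0) : ki => ki.
have two : (2 : R[i]) != 0 by rewrite pnatr_eq0.
apply: (mulfI two).
have {}k1 : a j k + a k j = b j k + b k j.
  by apply: (addIr (b j j + b k k)); move: k1 => k1;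
     transitivity (a j k + b j j + (b k k + a k j)); [ring | rewrite k1; ring].
transitivity ((a j k + a k j) + (a j k - a k j)); first by ring.
by rewrite k1 ki; ring.
Qed.

Lemma inner_basis2D (c d : R[i]) j k y z :
  let x := basis_vector R j + c *: basis_vector R k in
  inner x (y + d *: z) = inner x y + d * inner x z.
Proof.
rewrite /= !inner_basis2 !ell2_addE !ell2_scaleE; ring.
Qed.

Lemma sum_ipow (V : lmodType R[i]) (G : 'I_4 -> V) :
  \sum_(k < 4) 'i%C ^+ k *: G k =
  G (@Ordinal 4 0 isT) + 'i%C *: G (@Ordinal 4 1 isT) - G (@Ordinal 4 2 isT)
    - 'i%C *: G (@Ordinal 4 3 isT).
Proof.
have i2 : 'i%C ^+ 2 = -1 :> R[i] by rewrite sqr_i.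
have i3 : 'i%C ^+ 3 = - 'i%C :> R[i] by rewrite exprS sqr_i mulrN1.
rewrite !big_ord_recr big_ord0 /= expr0 expr1 i2 i3 add0r scale1r !scaleNr scale1r.
by congr (G _ + _ *: G _ - G _ - _ *: G _); apply: val_inj.
Qed.

Lemma eq_sum_operators A B A' B' :
  bounded_operator A -> bounded_operator B ->
  bounded_operator A' -> bounded_operator B' ->
  (forall (c : R[i]) j k, let x := basis_vector R j + c *: basis_vector R k in
     inner x (A x + B x) = inner x (A' x + B' x)) ->
  (fun x => A x + B x) = (fun x => A' x + B' x).
Proof.
have sum_ok (S T P : H -> H) : (forall x, P x = S x + T x) ->
    bounded_operator S -> bounded_operator T ->
    (forall (c : R[i]) x y, P (c *: x + y) = c *: P x + P y) /\
    exists M : R, forall x j, normc (P x j) <= M * ell2_norm x.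
  move=> PE bS bT; have [[MS hS] [MT hT]] :=
    (bounded_operator_entry bS, bounded_operator_entry bT).
  split; first by move=> c x y; rewrite !PE bS.1 bT.1 addrACA scalerDr.
  exists (MS + MT) => x j; rewrite PE ell2_addE mulrDl.
  exact: le_trans (le_normcD _ _) (lerD (hS _ _) (hT _ _)).
move=> bA bB bA' bB' q.
have [P PE] : {P : H -> H | forall x, P x = A x + B x} by exists (fun x => A x + B x).
have [P' PE'] : {P : H -> H | forall x, P x = A' x + B' x}
  by exists (fun x => A' x + B' x).
have [[l [M hM]] [l' [M' hM']]] := (sum_ok _ _ _ PE bA bB, sum_ok _ _ _ PE' bA' bB').
have PP' : P = P'.
  apply: (quadratic_form_ext l l' hM hM') => c j k.
  by have := q c j k; rewrite /= PE PE'.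
by apply/funext => x; rewrite -PE -PE' PP'.
Qed.

(* For each x, <x, T x> determines the values of the quadratic forms of Q_0 - Q_2
   and Q_1 - Q_3 at x, hence, by polarization, these two operators. *)
Lemma trace_decomposition_unique tau T (Q Q' : 'I_4 -> H -> H) :
  tracial_weight tau ->
  trace_decomposition tau T Q -> trace_decomposition tau T Q' ->
  \sum_(k < 4) 'i%C ^+ k * (fine (tau (Q k)))%:C%C =
  \sum_(k < 4) 'i%C ^+ k * (fine (tau (Q' k)))%:C%C :> R[i].
Proof.
move=> tw [Qp QT] [Qp' QT'].
pose n0 : 'I_4 := @Ordinal 4 0 isT; pose n1 : 'I_4 := @Ordinal 4 1 isT.
pose n2 : 'I_4 := @Ordinal 4 2 isT; pose n3 : 'I_4 := @Ordinal 4 3 isT.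
(* Quadratic forms of positive operators have real values, so one complex equation splits into two
   real ones. *)
have real_eq (a b c d : R[i]) : 0 <= a -> 0 <= b -> 0 <= c -> 0 <= d ->
    a + 'i%C * b = c + 'i%C * d -> a = c /\ b = d.
  move=> /ger0_Im + /ger0_Im + /ger0_Im + /ger0_Im.
  case: a => ar ai /= ->; case: b => br bi /= ->.
  case: c => cr ci /= ->; case: d => dr di /= -> [].
  by rewrite !(mul0r, mulr0, mul1r, subr0, oppr0, addr0, add0r) => -> ->.
(* The equalities of differences are rearranged into equalities of sums of positive operators, to
   which additivity of [tau] applies. *)
pose P0 x := Q n0 x + Q' n2 x; pose P0' x := Q' n0 x + Q n2 x.
pose P1 x := Q n1 x + Q' n3 x; pose P1' x := Q' n1 x + Q n3 x.
have PE x : P0 x + 'i%C *: P1 x = P0' x + 'i%C *: P1' x.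
  have := QT x; rewrite (QT' x) !sum_ipow => /eqP; rewrite -subr_eq0 => /eqP E.
  apply/eqP; rewrite -subr_eq0; apply/eqP/oppr_inj; rewrite oppr0 -[RHS]E.
  rewrite /P0 /P0' /P1 /P1' !scalerDr !opprD !opprK !addrA.
  move: (Q n0 x) (Q' n0 x) (Q n2 x) (Q' n2 x) ('i%C *: Q n1 x) ('i%C *: Q n3 x)
    ('i%C *: Q' n1 x) ('i%C *: Q' n3 x) => q0 q0' q2 q2' q1 q3 q1' q3'.
  by apply: ell2_eqP => j; rewrite !(ell2_addE, ell2_subE) /=; ring.
have bQ k : bounded_operator (Q k) by have [[]] := Qp k.
have bQ' k : bounded_operator (Q' k) by have [[]] := Qp' k.
have form (c : R[i]) j k : let x := basis_vector R j + c *: basis_vector R k in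
    inner x (P0 x) = inner x (P0' x) /\ inner x (P1 x) = inner x (P1' x).
  set x := _ + _ => /=.
  have innerD y z : inner x (y + z) = inner x y + inner x z.
    by rewrite -[z]scale1r inner_basis2D mul1r scale1r.
  have p k' : 0 <= inner x (Q k' x) by have [[_]] := Qp k'.
  have p' k' : 0 <= inner x (Q' k' x) by have [[_]] := Qp' k'.
  apply: real_eq; rewrite ?innerD ?addr_ge0//.
  by rewrite -!innerD -!inner_basis2D PE.
have P0E := eq_sum_operators (bQ n0) (bQ' n2) (bQ' n0) (bQ n2)
  (fun c j k => (form c j k).1).
have P1E := eq_sum_operators (bQ n1) (bQ' n3) (bQ' n1) (bQ n3)
  (fun c j k => (form c j k).2).
have pQ k : positive_operator (Q k) := (Qp k).1.
have pQ' k : positive_operator (Q' k) := (Qp' k).1.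
have fin k : tau (Q k) \is a fin_num.
  by have [? ?] := Qp k; rewrite ge0_fin_numE ?weight_ge0.
have fin' k : tau (Q' k) \is a fin_num.
  by have [? ?] := Qp' k; rewrite ge0_fin_numE ?weight_ge0.
have := congr1 tau P0E; rewrite !(weightD tw)//.
move=> /(congr1 fine); rewrite !fineD// => E0.
have := congr1 tau P1E; rewrite !(weightD tw)//.
move=> /(congr1 fine); rewrite !fineD// => E1.
rewrite !(sum_ipow (V := R[i]^o)) /GRing.scale/=.
move: E0 E1; set q0 := fine _; set q2' := fine _; set q0' := fine _.
set q2 := fine (tau (Q n2)); set q1 := fine _; set q3' := fine _.
set q1' := fine _; set q3 := fine (tau (Q n3)) => E0 E1.
have -> : q0 = q0' + q2 - q2' by rewrite -E0 addrK.
have -> : q1 = q1' + q3 - q3' by rewrite -E1 addrK.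
by rewrite !(rmorphB, rmorphD)/=; ring.
Qed.

Lemma trace_extE tau T (Q : 'I_4 -> H -> H) : tracial_weight tau ->
  trace_decomposition tau T Q ->
  trace_ext tau T = \sum_(k < 4) 'i%C ^+ k * (fine (tau (Q k)))%:C%C.
Proof.
move=> tw dQ; apply: xget_unique; first by exists Q.
by move=> z [Q' dQ' ->]; exact: trace_decomposition_unique dQ.
Qed.

End TraceExtension.

(** * Words and cells *)

Section Words.
Variables (R : realType) (X : similarity_system R).
Hypothesis X_limit : limit_fractal X.
Local Notation a := (left_end X).
Local Notation b := (right_end X).
Local Notation p := (arity X).
Local Notation w := (@wmap R X _).
Local Notation lambda := (@dilation R X _).
Local Notation F := (fractal X).

(* A multi-index of length n is represented by an infinite address, of which only
   the first n letters matter: this avoids casts when concatenating words. *)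
Definition address := forall m : nat, 'I_(p m).
Implicit Types (s t : address) (n k m : nat) (x y z : R).

Fixpoint word t n k : R -> R :=
  if k is k'.+1 then w (t n) \o word t n.+1 k' else id.

Fixpoint wratio t n k : R :=
  if k is k'.+1 then lambda (t n) * wratio t n.+1 k' else 1.

Lemma wordS t n k x : word t n k.+1 x = w (t n) (word t n.+1 k x).
Proof. by []. Qed.

Lemma word_eq s t n k : (forall m, (n <= m < n + k)%N -> s m = t m) ->
  word s n k = word t n k.
Proof.
elim: k n => [//|k IH] n st /=; rewrite st ?leqnn ?addnS ?ltnS ?leq_addr//.
rewrite IH// => m /andP[nm mk]; rewrite st// ltnW//= addnS -addSn//.
Qed.

Lemma word_cat t n k l x :
  word t n (k + l) x = word t n k (word t (n + k) l x).
Proof. by elim: k n => [|k IH] n; rewrite ?addn0//= IH addSnnS. Qed.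

Lemma wratio_gt0 t n k : 0 < wratio t n k.
Proof.
elim: k n => [|k IH] n //=; rewrite mulr_gt0//.
by have /andP[] := dilation_itv X_limit (t n).
Qed.

Lemma word_dist t n k x y :
  `|word t n k x - word t n k y| = wratio t n k * `|x - y|.
Proof.
elim: k n => [|k IH] n /=; first by rewrite mul1r.
by rewrite (wmap_similarity X_limit) IH mulrA.
Qed.

Lemma word_inj t n k : injective (word t n k).
Proof.
move=> x y xy; apply/eqP; rewrite -subr_eq0 -normr_eq0.
have := word_dist t n k x y; rewrite xy subrr normr0 => /esym/eqP.
by rewrite mulf_eq0 gt_eqF ?wratio_gt0.
Qed.

(** The dilation factor with a sign, which records the orientation of the word. *)
Definition slope t n k : R := word t n k 1 - word t n k 0.

Lemma normr_slope t n k : `|slope t n k| = wratio t n k.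
Proof. by rewrite /slope word_dist subr0 normr1 mulr1. Qed.

Lemma slope_neq0 t n k : slope t n k != 0.
Proof. by rewrite -normr_eq0 normr_slope gt_eqF ?wratio_gt0. Qed.

(* A map of R that scales distances is determined by its values at 0 and 1. *)
Lemma wordE t n k x : word t n k x = word t n k 0 + slope t n k * x.
Proof.
have := word_dist t n k x 0; have := word_dist t n k x 1.
have := normr_slope t n k; have r0 := wratio_gt0 t n k.
rewrite subr0 /slope; move: (word t n k x) (word t n k 1) (word t n k 0) r0.
move: (wratio t n k) => r u v z r0 h1 h2 h3.
have sq (c d : R) : `|c| = d -> c ^+ 2 = d ^+ 2.
  by move=> <-; rewrite -normrX ger0_norm ?sqr_ge0.
have {}h1 := sq _ _ h1; have {}h2 := sq _ _ h2; have {}h3 := sq _ _ h3.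
rewrite exprMn real_normK ?num_real// in h2.
rewrite exprMn real_normK ?num_real// in h3.
have vz : v - z != 0 by rewrite -sqrf_eq0 h1 sqrf_eq0 gt_eqF.
(* Subtracting the two squared relations cancels the quadratic terms in [u] and leaves twice the
   claim multiplied by [v - z]. *)
apply/eqP; rewrite -subr_eq0; apply/eqP; apply: (mulfI vz); rewrite mulr0.
have : r ^+ 2 * (x - 1) ^+ 2 = (u - v) ^+ 2 by rewrite h2.
have : r ^+ 2 * x ^+ 2 = (u - z) ^+ 2 by rewrite h3.
rewrite -h1 => e1 e2; nra.
Qed.

Lemma wmap_sub_itv n (i : 'I_(p n)) x : a <= x <= b -> a <= w i x <= b.
Proof.
by move=> xab; have := wmap_sub X_limit (i := i); move/(_ (w i x)); rewrite /= in_itv/=;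
  apply; exists x => //=; rewrite in_itv.
Qed.

Lemma word_itv t n k x : a <= x <= b -> a <= word t n k x <= b.
Proof. by move=> xab; elim: k n => [//|k IH] n; exact: wmap_sub_itv. Qed.

(** At the first level where the letters differ, the two points would lie in disjoint images of
    [[a, b]]. As long as the letters agree, injectivity strips off the common map. *)
Lemma word_disjoint s t n k y z : a <= y <= b -> a <= z <= b ->
  word s n k y = word t n k z -> forall m, (n <= m < n + k)%N -> s m = t m.
Proof.
move=> yab zab; elim: k n => [|k IH] n /=.
  by move=> _ m; rewrite addn0 ltnNge; case: (leqP n m).
move=> E; have st : s n = t n.
  apply/eqP; apply/negP => /negP st.
  have := wmap_disjoint X_limit st; apply/eqP/set0P.
  exists (w (s n) (word s n.+1 k y)); split.
    by exists (word s n.+1 k y) => //=; rewrite in_itv/=; exact: word_itv.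
  by rewrite E; exists (word t n.+1 k z) => //=; rewrite in_itv/=; exact: word_itv.
move: E; rewrite st => /(@word_inj t n 1) E m.
rewrite leq_eqVlt => /andP[/orP[/eqP <-//|nm] mk].
by apply: (IH _ E); rewrite nm/= addSnnS.
Qed.

End Words.

Section Cylinders.
Variables (R : realType) (X : similarity_system R).
Hypothesis X_limit : limit_fractal X.
Local Notation a := (left_end X).
Local Notation b := (right_end X).
Local Notation p := (arity X).
Local Notation w := (@wmap R X _).
Local Notation lambda := (@dilation R X _).
Local Notation F := (fractal X).
Implicit Types (s t : address X) (n k m : nat) (x y z : R).

Let ab : a < b := ends_lt X_limit.

(** No alphabet is empty, because [wmap_ends] provides a letter whose image contains [a]. *)
Lemma address_inhabited : inhabited (address X).
Proof.
suff H n : exists i : 'I_(p n), True by constructor => n; exact: (sval (cid (H n))).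
have /(_ a)[|i _ _] := @wmap_ends _ _ X_limit n; first by left.
by exists i.
Qed.

Definition splice n s t : address X := fun m => if (m < n)%N then s m else t m.

Lemma wimagesP n k (A : set R) x :
  wimages X n k A x <-> exists t y, A y /\ x = word t n k y.
Proof.
have [t0] := address_inhabited.
elim: k n x => [|k IH] n x.
  rewrite /wimages addn0 big_geq//; split=> [Ax|[t [y [Ay ->]]]//].
  by exists t0, x.
rewrite /wimages addnS big_ltn ?ltnS ?leq_addr//= -addSn; split.
  move=> [i _ [y]] /(IH n.+1)[t [z [Az ->]]] <-.
  exists (dfwith t n i), z; split => //; rewrite dfwithin; congr (w i _).
  rewrite (@word_eq _ _ (dfwith t n i) t)// => m /andP[nm _].
  by rewrite dfwithout// ltn_eqF.
move=> [t [y [Ay ->]]]; exists (t n) => //; exists (word t n.+1 k y) => //.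
by apply/(IH n.+1); exists t, y.
Qed.

Lemma tail_fractalP n x : tail_fractal X n x <->
  forall k, exists t y, a <= y <= b /\ x = word t n k y.
Proof.
split=> [Fx [|k]|Fx k _].
(* The intersection defining the tail starts at depth 1; depth 0 follows because the letters map
   [[a, b]] into itself. *)
- have /(_ isT)/wimagesP[t [y [/=]]] := Fx 1%N; rewrite in_itv/= => yab ->.
  by exists t, (word t n 1 y); split => //; exact: word_itv.
- by have /(_ isT)/wimagesP[t [y [/=]]] := Fx k.+1; rewrite in_itv/=; exists t, y.
- by apply/wimagesP; have [t [y [yab ->]]] := Fx k; exists t, y; rewrite /= in_itv.
Qed.

Lemma tail_fractal_itv n x : tail_fractal X n x -> a <= x <= b.
Proof. by move=> /tail_fractalP/(_ 0%N)[t [y [yab ->]]]. Qed.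

(** Each end is the image of an end under some letter, and this can be iterated to any depth. *)
Lemma tail_fractal_ends n : tail_fractal X n a /\ tail_fractal X n b.
Proof.
have [t0] := address_inhabited.
suff H k m u : u = a \/ u = b ->
    exists t v, (v = a \/ v = b) /\ u = word t m k v.
  have vab v : v = a \/ v = b -> a <= v <= b by case=> ->; rewrite lexx ltW.
  split; apply/tail_fractalP => k.
    by have [|t [v [/vab vv E]]] := H k n a; [left|exists t, v].
  by have [|t [v [/vab vv E]]] := H k n b; [right|exists t, v].
elim: k m u => [|k IH] m u uab; first by exists t0, u.
have [i _ [v vab <-]] := @wmap_ends _ _ X_limit m u uab.
have [t [v' [v'ab ->]]] := IH m.+1 v vab.
exists (dfwith t m i), v'; split => //; rewrite wordS dfwithin; congr (w i _).
rewrite (@word_eq _ _ (dfwith t m i) t)// => l /andP[ml _].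
by rewrite dfwithout// ltn_eqF.
Qed.

(** From left to right, disjointness forces every address of the image point to begin with the
    letters of [t], and injectivity removes them. From right to left, an address of [x] is prefixed
    with these letters. *)
Lemma word_tail t n k x : a <= x <= b ->
  tail_fractal X n (word t n k x) <-> tail_fractal X (n + k) x.
Proof.
move=> xab; split => /tail_fractalP Fx; apply/tail_fractalP => l.
  have [s [y [yab E]]] := Fx (k + l)%N; exists s, y; split => //.
  move: E; rewrite word_cat => E.
  have yab' : a <= word s (n + k) l y <= b by exact: word_itv.
  have st := word_disjoint X_limit xab yab' E.
  by move: E; rewrite (word_eq st) => /(word_inj X_limit).
(* The image point is reached from [y] by the [k + l] letters of [u] from level [n] on. The first
   [l] of them are kept, and the other [k] are absorbed in the point, which stays in [[a, b]]. *)
have [s [y [yab ->]]] := Fx l; pose u := splice (n + k) t s.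
exists u, (word u (n + l) k y); split; first exact: word_itv.
rewrite -word_cat [(l + k)%N]addnC word_cat (@word_eq _ _ u t) => [|m /andP[_ mk]].
  congr (word t n k _); rewrite (@word_eq _ _ u s)//.
  by move=> m /andP[km _]; rewrite /u /splice ltnNge km.
by rewrite /u /splice mk.
Qed.

(** The full interval, which is convex, instead of the piece of [F] in it; [cell_tail] recovers the
    latter. *)
Definition cell t n : set R := [set x | exists2 y, a <= y <= b & x = word t 0 n y].

Lemma cell_tail t n x : (cell t n x /\ F x) <->
  exists2 y, tail_fractal X n y & x = word t 0 n y.
Proof.
split=> [[[y yab ->] Fx]|[y Fy ->]].
  by exists y => //; move/(word_tail t 0 n yab): Fx.
have yab := tail_fractal_itv Fy; split; first by exists y.
exact/(word_tail t 0 n yab).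
Qed.

Lemma fractal_cell n x : F x -> exists t, cell t n x.
Proof. by move=> /tail_fractalP/(_ n)[t [y [yab ->]]]; exists t, y. Qed.

Lemma cell_disjoint s t n x : cell s n x -> cell t n x ->
  forall m, (m < n)%N -> s m = t m.
Proof.
move=> [y yab ->] [z zab E] m mn.
by apply: (word_disjoint X_limit yab zab E); rewrite add0n.
Qed.

Lemma cell_ends t n : [/\ F (word t 0 n a), F (word t 0 n b),
  cell t n (word t 0 n a) & cell t n (word t 0 n b)].
Proof.
have [Fa Fb] := tail_fractal_ends n.
have aab : a <= a <= b by rewrite lexx ltW.
have bab : a <= b <= b by rewrite lexx ltW.
by split; [exact/(word_tail t 0 n aab)|exact/(word_tail t 0 n bab)|exists a|exists b].
Qed.

Lemma cell_eq s t n : (forall m, (m < n)%N -> s m = t m) -> cell s n = cell t n.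
Proof. by move=> st; rewrite /cell (@word_eq _ _ s t). Qed.

(** The product condition says that [z] lies between [x] and [y] in either order. An affine map only
    multiplies the product by the square of its slope. *)
Lemma cell_convex t n x y z : cell t n x -> cell t n y ->
  (z - x) * (z - y) <= 0 -> cell t n z.
Proof.
move=> [u uab ->] [v vab ->] h; have d0 := slope_neq0 X_limit t 0 n.
set d := slope t 0 n in d0 *; pose c := word t 0 n 0.
exists ((z - c) / d); last by rewrite wordE// mulrCA divff// mulr1 addrC subrK.
move: h; rewrite (wordE _ _ _ _ u)// (wordE _ _ _ _ v)// -/c -/d.
set q := (z - c) / d; have -> : z = c + d * q by rewrite /q mulrCA divff// mulr1 addrC subrK.
have -> : (c + d * q - (c + d * u)) * (c + d * q - (c + d * v)) =
  d ^+ 2 * ((q - u) * (q - v)) by ring.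
rewrite pmulr_rle0 ?exprn_even_gt0// => h.
by move: uab vab => /andP[? ?] /andP[? ?]; apply/andP; split; nra.
Qed.

Lemma cell_sub t n m : (n <= m)%N -> cell t m `<=` cell t n.
Proof.
move=> nm x [y yab ->]; exists (word t n (m - n) y); first exact: word_itv.
by rewrite -{1}(subnKC nm) word_cat.
Qed.

End Cylinders.

(** * Lacunae and the basis of the spectral triple *)

Section Geometry.
Variables (R : realType) (X : similarity_system R).
Hypothesis X_limit : limit_fractal X.
Local Notation a := (left_end X).
Local Notation b := (right_end X).
Local Notation F := (fractal X).
Implicit Types (s t : address X) (n k m : nat) (x y z u v : R).

Let ab : a < b := ends_lt X_limit.

Lemma fractal_closed : closed F.
Proof. exact: compact_closed (@norm_hausdorff _ _) (fractal_compact X_limit). Qed.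

Lemma fractal_no_interval u v : u < v -> exists2 z, u <= z <= v & ~ F z.
Proof.
move=> uv; apply: contrapT => nz.
have uvF : `[u, v] `<=` F.
  move=> z; rewrite /= in_itv/= => zuv; apply: contrapT => Fz.
  by apply: nz; exists z.
have uin : `[u, v]%classic u by rewrite /= in_itv/= lexx ltW.
have vin : `[u, v]%classic v by rewrite /= in_itv/= lexx ltW.
have := connected_component_max uin uvF (@segment_connected _ u v).
rewrite (fractal_disconnected X_limit (uvF _ uin)) => /(_ _ vin)/= vu.
by rewrite vu ltxx in uv.
Qed.

(** A point of [[u, v]] outside [F] is missed by all cells of some level, hence by the smaller cells
    of all later levels. *)
Lemma cells_avoid_interval u v : u < v -> exists N, forall n, (N <= n)%N ->
  forall t, ~ (forall z, u <= z <= v -> cell t n z).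
Proof.
move=> uv; have [z zuv Fz] := fractal_no_interval uv.
have [N nN] : exists N, forall t, ~ cell t N z.
  apply: contrapT => h; apply: Fz; apply/(tail_fractalP X_limit) => k.
  apply: contrapT => hk; apply: h; exists k => t [y yab zE].
  by apply: hk; exists t, y.
by exists N => n Nn t /(_ z zuv)/(cell_sub X_limit Nn); exact: nN.
Qed.

Definition cell_length t n : R := wratio t 0 n * (b - a).

(* A cell of length 2h contains one of the grid intervals [a+ih, a+(i+1)h],
   each of which meets the complement of F. *)
Lemma cells_shrink (e : R) : 0 < e -> exists N, forall n, (N <= n)%N ->
  forall t, cell_length t n < e.
Proof.
move=> e0; pose h := e / 2; have h0 : 0 < h by rewrite divr_gt0.
(* The index chosen below is one more than the truncation of a number less than [(b - a) / h]. *)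
pose K := (Num.trunc ((b - a) / h)).+2.
have grid i : exists N, forall n, (N <= n)%N -> forall t,
    ~ (forall z, a + i%:R * h <= z <= a + i.+1%:R * h -> cell t n z).
  by apply: cells_avoid_interval; rewrite ltrD2l ltr_pM2r// ltr_nat.
have [Nf hNf] := choice grid.
exists (\max_(i < K) Nf i) => n Nn t; rewrite ltNge; apply/negP => le.
have [_ _ ca cb] := cell_ends X_limit t n.
have lenE : `|word t 0 n b - word t 0 n a| = cell_length t n.
  by rewrite (word_dist X_limit) gtr0_norm ?subr_gt0.
(* The ends of the cell are put in increasing order, since the word may reverse orientation. *)
have [c [d [cd cc dd]]] : exists c d, [/\ c + e <= d, cell t n c & cell t n d].
  case: (leP (word t 0 n a) (word t 0 n b)) => abw.
    exists (word t 0 n a), (word t 0 n b); split => //.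
    by rewrite -lenE ger0_norm ?subr_ge0 ?lerBrDl// in le.
  exists (word t 0 n b), (word t 0 n a); split => //.
  by rewrite -lenE ltr0_norm ?subr_lt0// opprB lerBrDl in le.
have cab z : cell t n z -> a <= z <= b.
  by move=> [y yab ->]; exact: word_itv.
have /andP[ac _] := cab _ cc; have /andP[_ db] := cab _ dd.
pose q := (c - a) / h; have q0 : 0 <= q by apply: divr_ge0; [rewrite subr_ge0|exact: ltW].
have cE : c = a + q * h by rewrite mulfVK ?gt_eqF// addrC subrK.
(* [a + i * h] is the first grid point to the right of [c], at distance at most [h]; the next grid
   point is thus at most [c + 2 * h <= d]. *)
pose i := (Num.trunc q).+1.
have /andP[iq qi] := truncn_itv q0.
have iK : (i < K)%N.
  rewrite /i /K !ltnS truncn_le_nat; apply: lt_trans (truncnS_gt _).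
  by rewrite ltr_pM2r ?invr_gt0// ltrD2r; lra.
apply: (hNf i n _ t).
  by apply: leq_trans Nn; exact: (@leq_bigmax _ (fun j : 'I_K => Nf j) (Ordinal iK)).
move=> z /andP[z1 z2]; apply: (cell_convex X_limit cc dd).
have e2 : e = 2 * h by rewrite /h; field.
have cz : c <= z.
  by apply: le_trans z1; rewrite cE lerD2l ler_pM2r// ltW.
have zd : z <= d.
  apply: (le_trans z2); apply: le_trans cd; rewrite cE -addrA lerD2l e2 -mulrDl ler_pM2r//.
  rewrite /i -addn2 natrD; lra.
by rewrite mulr_ge0_le0 ?subr_ge0// subr_le0.
Qed.

Lemma cell_diam t n x y : cell t n x -> cell t n y -> `|x - y| <= cell_length t n.
Proof.
move=> [u /andP[au ub] ->] [v /andP[av vb] ->].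
rewrite (word_dist X_limit) ler_pM2l ?wratio_gt0// ler_norml; lra.
Qed.

(* Orientation-free, as the symmetries may exchange the two ends. *)
Definition between u v x := (x - u) * (x - v) < 0.

Lemma between_lt u v x : u < v -> between u v x <-> u < x < v.
Proof.
move=> uv; rewrite /between; split=> [h|/andP[ux xv]]; last by nra.
by apply/andP; split; rewrite ltNge; apply/negP => h'; nra.
Qed.

Definition gap u v := [/\ u != v, F u, F v & forall x, between u v x -> ~ F x].

Lemma gap_sym u v : gap u v -> gap v u.
Proof.
move=> [uv Fu Fv h]; split => //; first by rewrite eq_sym.
by move=> x xvu; apply: h; rewrite /between mulrC.
Qed.

Lemma gap_component u v x : gap u v -> u < x < v ->
  connected_component (`[a, b] `\` F) x = `]u, v[%classic.
Proof.
move=> [_ Fu Fv h] uxv; have uv : u < v by case/andP: uxv => /lt_trans; apply.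
have G z : u < z < v -> (`[a, b]%classic `\` F) z.
  move=> uzv; split; last exact/h/between_lt.
  have /andP[au _] := tail_fractal_itv X_limit Fu.
  have /andP[_ vb] := tail_fractal_itv X_limit Fv.
  by move: uzv => /andP[uz zv]; rewrite /= in_itv/=; apply/andP; split; lra.
apply/seteqP; split.
  move=> z zI; have I_itv : is_interval (connected_component (`[a, b] `\` F) x).
    exact/connected_intervalP/component_connected.
  have xI : connected_component (`[a, b] `\` F) x x.
    exact/connected_component_refl/G.
  have FI y : F y -> ~ connected_component (`[a, b] `\` F) x y.
    by move=> Fy /connected_component_sub[].
  rewrite /= in_itv/=; apply/andP; split; rewrite ltNge; apply/negP => hz.
    by apply: (FI u Fu); apply: (I_itv z x) => //; case/andP: uxv => ? ?; lra.
  by apply: (FI v Fv); apply: (I_itv x z) => //; case/andP: uxv => ? ?; lra.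
apply: connected_component_max.
- by rewrite /= in_itv.
- by move=> z; rewrite /= in_itv/=; exact: G.
- exact/connected_intervalP/interval_is_interval.
Qed.

Lemma fractal_max x : a <= x -> exists u, [/\ F u, u <= x &
  forall z, F z -> z <= x -> z <= u].
Proof.
move=> ax; pose A := F `&` [set z | z <= x].
have A0 : A !=set0.
  by exists a; split => //; exact: (tail_fractal_ends X_limit 0).1.
have Ax : has_ubound A by exists x => z [].
have Acl : closed A by apply: closedI; [exact: fractal_closed|exact: closed_le].
have [Fu ux] := Acl _ (closure_sup A0 Ax).
exists (sup A); split => // z Fz zx.
by apply: ub_le_sup.
Qed.

Lemma fractal_min x : x <= b -> exists v, [/\ F v, x <= v &
  forall z, F z -> x <= z -> v <= z].
Proof.
move=> xb; pose A := F `&` [set z | x <= z].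
have A0 : A !=set0.
  by exists b; split => //; exact: (tail_fractal_ends X_limit 0).2.
have Ax : has_lbound A by exists x => z [].
have Acl : closed A by apply: closedI; [exact: fractal_closed|exact: closed_ge].
have infA : closure A (inf A).
  move=> U /nbhs_ballP[e /= e0 eU].
  have [z Az ze] := inf_adherent e0 (conj A0 Ax).
  exists z; split => //; apply: eU; rewrite /ball/= distrC ger0_norm ?ltrBlDl//.
  by rewrite subr_ge0; exact: ge_inf.
have [Fv xv] := Acl _ infA; exists (inf A); split => // z Fz xz.
by apply: ge_inf.
Qed.

(** The ends of the component of [x] are the points of [F] nearest to [x] on either side. They exist
    since [F] is closed and contains [a] and [b]. *)
Lemma lacunaP (I : set R) : lacuna X I <->
  exists u v, [/\ u < v, gap u v & I = `]u, v[%classic].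
Proof.
split=> [[x [xab Fx] ->]|[u [v [uv g ->]]]]; last first.
  have m : u < (u + v) / 2 < v by apply/andP; split; lra.
  exists ((u + v) / 2); last by rewrite (gap_component g m).
  apply: (@connected_component_sub _ _ ((u + v) / 2)).
  by rewrite (gap_component g m) /= in_itv.
move: xab; rewrite /= in_itv/= => /andP[ax xb].
have [u [Fu ux hu]] := fractal_max ax; have [v [Fv xv hv]] := fractal_min xb.
have {}ux : u < x by rewrite lt_neqAle ux andbT; apply/eqP => ux'; rewrite ux' in Fu.
have {}xv : x < v by rewrite lt_neqAle xv andbT; apply/eqP => xv'; rewrite xv' in Fx.
have g : gap u v.
  split => //; first by rewrite lt_eqF// (lt_trans ux).
  move=> z /(between_lt _ (lt_trans ux xv))/andP[uz zv] Fz.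
  by case: (leP z x) => [/(hu _ Fz)|/ltW/(hv _ Fz)]; lra.
by exists u, v; split; rewrite ?(lt_trans ux)// (gap_component g)// ux.
Qed.

End Geometry.

(** * Coding basis vectors by ordered pairs of endpoints *)

Section Codes.
Variables (R : realType) (X : similarity_system R).
Hypothesis X_limit : limit_fractal X.
Local Notation a := (left_end X).
Local Notation b := (right_end X).
Local Notation p := (arity X).
Local Notation w := (@wmap R X _).
Local Notation lambda := (@dilation R X _).
Local Notation F := (fractal X).
Local Notation J := (triple_basis X).
Implicit Types (s t : address X) (n k m : nat) (x y z u v : R) (j : J).

Let ab : a < b := ends_lt X_limit.

Lemma multi_index_address n (sigma : multi_index X n) :
  exists t, forall i : 'I_n, sigma i = t i.
Proof.
have [t0] := address_inhabited X_limit.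
have H m : exists i : 'I_(p m), forall h : (m < n)%N, i = sigma (Ordinal h).
  have [h|h] : (m < n)%N \/ ~~ (m < n)%N by apply/orP; exact: orbN.
    exists (sigma (Ordinal h)) => h'.
    by have -> : h' = h by exact: bool_irrelevance.
  by exists (t0 m) => h'; rewrite h' in h.
exists (fun m => sval (cid (H m))) => -[m h].
by rewrite (svalP (cid (H m)) h).
Qed.

Lemma wword_word n (sigma : multi_index X n) t :
  (forall i : 'I_n, sigma i = t i) -> wword sigma = word t 0 n.
Proof.
move=> st; rewrite /wword.
under eq_bigr do rewrite st.
rewrite -(big_mkord xpredT (fun m => w (t m))).
suff H k m : \big[comp/id]_(m <= i < m + k) w (t i) = word t m k.
  by rewrite -(H n 0%N) add0n.
elim: k m => [|k IH] m; first by rewrite addn0 big_geq.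
by rewrite addnS big_ltn ?ltnS ?leq_addr// -addSn IH.
Qed.

Lemma lambdaword_wratio n (sigma : multi_index X n) t :
  (forall i : 'I_n, sigma i = t i) -> lambdaword sigma = wratio t 0 n.
Proof.
move=> st; rewrite /lambdaword.
under eq_bigr do rewrite st.
rewrite -(big_mkord xpredT (fun m => lambda (t m))).
suff H k m : \prod_(m <= i < m + k) lambda (t i) = wratio t m k.
  by rewrite -(H n 0%N) add0n.
elim: k m => [|k IH] m; first by rewrite addn0 big_geq.
by rewrite addnS big_ltn ?ltnS ?leq_addr// -addSn IH.
Qed.

Lemma word_image t n : word t 0 n @` `[a, b] = cell t n.
Proof.
apply/seteqP; split=> [_ [y /= + <-]|x [y yab ->]].
  by rewrite in_itv/= => yab; exists y.
by exists y => //=; rewrite in_itv.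
Qed.

(** Both orders occur: words may reverse orientation, and each filled interval carries two basis
    vectors. *)
Definition word_ends t m u v :=
  (u = word t 0 m a /\ v = word t 0 m b) \/
  (u = word t 0 m b /\ v = word t 0 m a).

Lemma word_ends_lt t m : exists u v, word_ends t m u v /\ u < v.
Proof.
have ne : word t 0 m a != word t 0 m b.
  by apply/eqP => /(word_inj X_limit) E; have := ab; rewrite E ltxx.
case: (ltgtP (word t 0 m a) (word t 0 m b)) ne => // h _.
  by exists (word t 0 m a), (word t 0 m b); split => //; left.
by exists (word t 0 m b), (word t 0 m a); split => //; right.
Qed.

Lemma word_ends_sym t m u v : word_ends t m u v -> word_ends t m v u.
Proof. by case=> [[-> ->]|[-> ->]]; [right|left]. Qed.

Lemma word_ends_cell t m u v : word_ends t m u v ->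
  [/\ u != v, F u, F v, cell t m u & cell t m v].
Proof.
have [Fa Fb ca cb] := cell_ends X_limit t m.
have ne : word t 0 m a != word t 0 m b.
  by apply/eqP => /(word_inj X_limit) E; have := ab; rewrite E ltxx.
by case=> [[-> ->]|[-> ->]]; split => //; rewrite eq_sym.
Qed.

Lemma word_ends_itv t m u v : word_ends t m u v -> u < v ->
  cell t m = `[u, v]%classic.
Proof.
move=> E uv; have [_ _ _ cu cv] := word_ends_cell E.
apply/seteqP; split=> x; rewrite /= in_itv/=; last first.
  move=> /andP[ux xv]; apply: (cell_convex X_limit cu cv).
  by rewrite mulr_ge0_le0 ?subr_ge0// subr_le0.
move=> [y /andP[ay yb] ->]; move: E uv.
rewrite /word_ends (wordE X_limit t 0 m a) (wordE X_limit t 0 m b).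
rewrite (wordE X_limit t 0 m y).
move: (slope t 0 m) (word t 0 m 0) => d c.
case=> [[-> ->]|[-> ->]]; rewrite ltrD2l => cd.
  have d0 : 0 < d by rewrite -(pmulr_lgt0 d (_ : 0 < b - a)) ?subr_gt0// mulrBr subr_gt0.
  by rewrite !lerD2l !ler_pM2l ?ay.
have d0 : d < 0 by rewrite -(pmulr_llt0 d (_ : 0 < b - a)) ?subr_gt0// mulrBr subr_lt0.
by rewrite !lerD2l !ler_nM2l ?ay ?yb.
Qed.

Lemma interval_ofP (k : interval_index X) : exists u v, [/\ u < v,
  inf (interval_of k) = u, sup (interval_of k) = v &
  match k with
  | inl _ => gap X u v /\ interval_of k = `]u, v[%classic
  | inr f => exists t, word_ends t (val f).1 u v /\ interval_of k = `[u, v]%classic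
  end].
Proof.
case: k => [[I /= /set_mem/(lacunaP X_limit)[u [v [uv g ->]]]]|[[m I] /= /set_mem[sigma /= ->]]].
  by exists u, v; rewrite inf_itv ?bnd_simp// sup_itv ?bnd_simp//.
have [t st] := multi_index_address sigma; rewrite (wword_word st) word_image.
have [u [v [E uv]]] := word_ends_lt t m.
rewrite (word_ends_itv E uv); exists u, v.
rewrite inf_itv ?bnd_simp ?ltW// sup_itv ?bnd_simp ?ltW//.
by split => //; exists t.
Qed.

Definition kind j : option nat :=
  match j.1 with inl _ => None | inr f => Some (val f).1 end.

Definition flip j : J := (j.1, ~~ j.2).

(* Determines j. Symmetries act on codes by acting on the two endpoints. *)
Definition interval_code j : option nat * R * R := (kind j, endpoint j, endpoint (flip j)).

(** The range of [interval_code], as [interval_code_valid] and [interval_code_surj] show. *)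
Definition valid_code (c : option nat * R * R) : Prop :=
  match c.1.1 with
  | None => gap X c.1.2 c.2
  | Some m => exists t, word_ends t m c.1.2 c.2
  end.

Lemma interval_code_valid j : valid_code (interval_code j).
Proof.
case: j => k e; have [u [v [uv iu sv]]] := interval_ofP k.
rewrite /interval_code /flip /endpoint /kind /= iu sv.
case: k iu sv => [I|f] _ _ /=.
  by case: e => -[g _] //=; exact: gap_sym.
by case: e => -[t [E _]] /=; exists t => //; exact: word_ends_sym.
Qed.

Lemma endpoint_lt (k : interval_index X) : endpoint ((k, false) : J) < endpoint ((k, true) : J).
Proof. by have [u [v [uv iu sv _]]] := interval_ofP k; rewrite /endpoint/= iu sv. Qed.

Lemma interval_code_inj : injective interval_code.
Proof.
move=> [k e] [k' e'] [K E1 E2].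
have lt := endpoint_lt k; have lt' := endpoint_lt k'.
(* The order of the two endpoints in the code tells the left end from the right one. *)
have ee : e = e'.
  by case: e e' K E1 E2 => [] [] //= K E1 E2; move: lt lt'; rewrite E1 E2 => l1 l2;
    have := lt_trans l1 l2; rewrite ltxx.
move: K E1 E2; rewrite -{}ee => K E1 E2; congr (_, _).
have [iE sE] : inf (interval_of k) = inf (interval_of k') /\
    sup (interval_of k) = sup (interval_of k').
  by case: e K E1 E2.
have [u [v [_ iu sv H]]] := interval_ofP k.
have [u' [v' [_ iu' sv' H']]] := interval_ofP k'.
have uu : u = u' by rewrite -iu -iu'.
have vv : v = v' by rewrite -sv -sv'.
move: K H H'; rewrite -{}uu -{}vv {iu sv iu' sv' lt lt' iE sE E1 E2}.
case: k k' => [I|f] [I'|f'] //=.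
  move=> _ [_ IE] [_ IE']; congr (inl _); apply: val_inj => /=.
  by rewrite IE IE'.
move=> [K] [t [_ IE]] [t' [_ IE']]; congr (inr _); apply: val_inj => /=.
by move: K IE IE'; case: (val f) (val f') => [m I] [m' I'] /= -> -> ->.
Qed.

Lemma valid_code_neq c : valid_code c -> c.1.2 != c.2.
Proof.
case: c => [[[m|] u] v]; rewrite /valid_code /=; last by case.
by move=> [t] /word_ends_cell[].
Qed.

Lemma interval_code_surj c : valid_code c -> exists j, interval_code j = c.
Proof.
move=> vc; have := valid_code_neq vc; move: vc; case: c => [[q u] v].
(* A decreasing pair codes the right end of the interval whose left end has the increasing pair as
   code. *)
suff H (u' v' : R) : u' < v' -> valid_code (q, u', v') ->
    exists k : interval_index X, interval_code ((k, false) : J) = (q, u', v').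
  move=> vc /=; rewrite neq_lt => /orP[uv|vu].
    by have [k <-] := H _ _ uv vc; exists (k, false).
  have vc' : valid_code (q, v, u).
    case: q vc {H} => [m [t E]|g]; first by exists t; exact: word_ends_sym.
    exact: gap_sym.
  by have [k E] := H _ _ vu vc'; exists (k, true); case: E => <- <- <-.
move=> uv; case: q => [m|]; rewrite /valid_code /=.
  move=> [t E]; have Fm : filled X (m, cell t m).
    exists (fun i : 'I_m => t i) => /=; rewrite -word_image; congr (_ @` _).
    by rewrite (@wword_word _ _ t).
  exists (inr (SigSub (mem_set Fm))); rewrite /interval_code /kind /endpoint /=.
  by rewrite (word_ends_itv E uv) inf_itv ?bnd_simp ?ltW// sup_itv ?bnd_simp ?ltW.
move=> g; have L : lacuna X `]u', v'[%classic by apply/lacunaP => //; exists u', v'.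
exists (inl (SigSub (mem_set L))); rewrite /interval_code /kind /endpoint /=.
by rewrite inf_itv ?bnd_simp// sup_itv ?bnd_simp.
Qed.

Lemma endpoint_fractal j : F (endpoint j).
Proof.
have := interval_code_valid j; rewrite /valid_code /=; case: (kind j) => [m [t]|[]//].
by move=> /word_ends_cell[].
Qed.

Lemma interval_lengthE j :
  interval_length (interval_of j.1) = `|endpoint j - endpoint (flip j)|.
Proof.
case: j => k e; have := endpoint_lt k; rewrite /interval_length /endpoint /flip /=.
by case: e => /= h; [rewrite gtr0_norm ?subr_gt0 | rewrite ltr0_norm ?subr_lt0// opprB].
Qed.

End Codes.

(** * Generating symmetries *)

Section Symmetries.
Variables (R : realType) (X : similarity_system R).
Hypothesis X_limit : limit_fractal X.
Local Notation a := (left_end X).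
Local Notation b := (right_end X).
Local Notation p := (arity X).
Local Notation F := (fractal X).
Local Notation J := (triple_basis X).
Implicit Types (s t : address X) (n k m : nat) (x y z u v : R) (j : J).

Let ab : a < b := ends_lt X_limit.

(* The generating symmetry from w_s(F_n) to w_t(F_n), extended to R. *)
Definition symmetry s t n x : R := word t 0 n ((x - word s 0 n 0) / slope s 0 n).

Lemma symmetry_word s t n y : symmetry s t n (word s 0 n y) = word t 0 n y.
Proof.
by rewrite /symmetry (wordE X_limit s) addrC addKr mulrC mulKf// slope_neq0.
Qed.

Lemma word_surj s n x : exists y, x = word s 0 n y.
Proof.
exists ((x - word s 0 n 0) / slope s 0 n).
by rewrite (wordE X_limit s) mulrCA divff ?slope_neq0// mulr1 addrC subrK.
Qed.

Lemma symmetryK s t n : cancel (symmetry s t n) (symmetry t s n).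
Proof. by move=> x; have [y ->] := word_surj s n x; rewrite !symmetry_word. Qed.

Lemma symmetry_cell s t n x : cell s n x -> cell t n (symmetry s t n x).
Proof. by move=> [y yab ->]; rewrite symmetry_word; exists y. Qed.

Lemma symmetry_fractal s t n x :
  cell s n x -> F x -> F (symmetry s t n x).
Proof.
move=> [y yab ->] /(word_tail X_limit s 0 n yab) Fy; rewrite symmetry_word.
exact/(word_tail X_limit t 0 n yab).
Qed.

Lemma symmetry_dist s t n x y : `|symmetry s t n x - symmetry s t n y| =
  wratio t 0 n / wratio s 0 n * `|x - y|.
Proof.
have [x' ->] := word_surj s n x; have [y' ->] := word_surj s n y.
rewrite !symmetry_word !(word_dist X_limit) mulrA mulfVK//.
by rewrite gt_eqF ?wratio_gt0.
Qed.

Lemma between_word t n u v x :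
  between (word t 0 n u) (word t 0 n v) (word t 0 n x) <-> between u v x.
Proof.
rewrite /between (wordE X_limit t 0 n u) (wordE X_limit t 0 n v).
rewrite (wordE X_limit t 0 n x).
have d0 := slope_neq0 X_limit t 0 n; move: (slope _ _ _) (word _ _ _ _) d0 => d c d0.
have -> : (c + d * x - (c + d * u)) * (c + d * x - (c + d * v)) =
  d ^+ 2 * ((x - u) * (x - v)) by ring.
by rewrite pmulr_rlt0 ?exprn_even_gt0.
Qed.

Lemma between_symmetry s t n u v x : between u v x ->
  between (symmetry s t n u) (symmetry s t n v) (symmetry s t n x).
Proof.
have [u' ->] := word_surj s n u; have [v' ->] := word_surj s n v.
have [x' ->] := word_surj s n x; rewrite !symmetry_word.
by move=> /between_word h; apply/between_word.
Qed.

Definition symmetry_code s t n (c : option nat * R * R) : option nat * R * R :=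
  (c.1.1, symmetry s t n c.1.2, symmetry s t n c.2).

(** The bound on the level keeps the filled intervals whose words have at least [n] letters; the
    symmetry replaces the first [n] letters. *)
Definition inner_code t n (c : option nat * R * R) :=
  [/\ cell t n c.1.2, cell t n c.2 & forall m, c.1.1 = Some m -> (n <= m)%N].

Lemma symmetry_codeK s t n : cancel (symmetry_code s t n) (symmetry_code t s n).
Proof. by move=> [[q u] v]; rewrite /symmetry_code /= !symmetryK. Qed.

Lemma inner_symmetry_code s t n c :
  inner_code s n c -> inner_code t n (symmetry_code s t n c).
Proof. by case: c => [[q u] v] [/= cu cv h]; split => //; exact: symmetry_cell. Qed.

(** For a lacuna, a point of [F] strictly between the image endpoints would lie in the target cell
    by convexity, and the inverse symmetry would carry it into the original gap. For a filled
    interval, the word begins with the letters of [s], and these are replaced by those of [t]. *)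
Lemma valid_symmetry_code s t n c : valid_code X c -> inner_code s n c ->
  valid_code X (symmetry_code s t n c).
Proof.
case: c => [[[m|] u] v]; rewrite /valid_code /=; last first.
  move=> [uv Fu Fv h] [/= cu cv _]; split.
  - by rewrite (can_eq (symmetryK s t n)).
  - exact: symmetry_fractal.
  - exact: symmetry_fractal.
  move=> x xuv Fx; have cx : cell t n x.
    apply: (cell_convex X_limit (symmetry_cell t cu) (symmetry_cell t cv)).
    exact: ltW.
  apply: (h (symmetry t s n x)); last exact: symmetry_fractal.
  by have := between_symmetry t s n xuv; rewrite !symmetryK.
move=> [r E] [/= cu cv /(_ _ erefl) nm].
have [_ _ _ cru _] := word_ends_cell X_limit E.
have sr := cell_disjoint X_limit cu (cell_sub X_limit nm cru).
exists (splice n t r).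
have key y : symmetry s t n (word r 0 m y) = word (splice n t r) 0 m y.
  rewrite -{1 2}(subnKC nm) !word_cat !add0n (@word_eq _ _ r s 0 n); last first.
    by move=> l /= ln; rewrite sr.
  rewrite symmetry_word (@word_eq _ _ (splice n t r) t 0 n); last first.
    by move=> l /= ln; rewrite /splice ln.
  congr (word t 0 n _); rewrite (@word_eq _ _ (splice n t r) r n)// => l /andP[nl _].
  by rewrite /splice ltnNge nl.
by case: E => [[-> ->]|[-> ->]]; [left|right]; rewrite !key.
Qed.

Definition inner_part t n : set J := [set j | inner_code t n (interval_code j)].

(** [phi] exchanges the two inner parts along the symmetry and its inverse and fixes every other
    index. Disjointness of the cells makes these cases exclusive, so that [phi] is an involution. *)
Lemma swap_exists s t n : (forall x, cell s n x -> ~ cell t n x) ->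
  exists phi : J -> J, [/\ involutive phi,
    forall j, inner_part t n (phi j) <-> inner_part s n j &
    forall j, inner_part s n j -> interval_code (phi j) = symmetry_code s t n (interval_code j)].
Proof.
move=> st.
have excl j : inner_part s n j -> ~ inner_part t n j.
  by move=> [cu _ _] [cu' _ _]; exact: (st _ cu cu').
have H j : exists j', [/\
    inner_part s n j -> interval_code j' = symmetry_code s t n (interval_code j),
    inner_part t n j -> interval_code j' = symmetry_code t s n (interval_code j) &
    ~ inner_part s n j -> ~ inner_part t n j -> j' = j].
  have [sj|nsj] := pselect (inner_part s n j).
    have [j' E] := interval_code_surj X_limit
      (valid_symmetry_code t (interval_code_valid X_limit j) sj).
    by exists j'; split => // tj; exfalso; exact: (excl j).
  have [tj|ntj] := pselect (inner_part t n j); last by exists j.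
  have [j' E] := interval_code_surj X_limit
    (valid_symmetry_code s (interval_code_valid X_limit j) tj).
  by exists j'.
have [phi hphi] := choice H.
have phis j : inner_part s n j -> inner_part t n (phi j).
  move=> sj; rewrite /inner_part /=; have [-> // _ _] := hphi j.
  exact: inner_symmetry_code.
have phit j : inner_part t n j -> inner_part s n (phi j).
  move=> tj; rewrite /inner_part /=; have [_ -> // _] := hphi j.
  exact: inner_symmetry_code.
have phiK : involutive phi.
  move=> j; have [hs ht hn] := hphi j; have [hs' ht' _] := hphi (phi j).
  have [sj|nsj] := pselect (inner_part s n j).
    apply: (interval_code_inj X_limit); rewrite ht'; last exact: phis.
    by rewrite hs// symmetry_codeK.
  have [tj|ntj] := pselect (inner_part t n j); last by rewrite !hn.
  apply: (interval_code_inj X_limit); rewrite hs'; last exact: phit.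
  by rewrite ht// symmetry_codeK.
exists phi; split => // [j|j sj]; last by have [->] := hphi j.
by split=> [/phit|/phis//]; rewrite phiK.
Qed.

Lemma word_codes_finite m : finite_set [set c : option nat * R * R |
  c.1.1 = Some m /\ exists t, word_ends t m c.1.2 c.2].
Proof.
pose T : finType := {dffun forall i : 'I_m, 'I_(p i)}.
pose f (c : T * bool) := (Some m,
  wword c.1 (if c.2 then a else b), wword c.1 (if c.2 then b else a)).
apply: (@sub_finite_set _ _ (f @` setT)); last exact/finite_image/finite_finset.
move=> [[q u] v] [/= -> [t E]].
pose sigma : T := [ffun i : 'I_m => t i].
have ws : wword sigma = word t 0 m.
  by apply: wword_word => i; rewrite ffunE.
by case: E => [[-> ->]|[-> ->]]; [exists (sigma, true)|exists (sigma, false)];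
  rewrite // /f /= ws.
Qed.

Lemma subset1_finite_set (T : Type) (A : set T) :
  (forall i j : T, A i -> A j -> i = j) -> finite_set A.
Proof.
move=> A1; have [[x Ax]|A0] := pselect (A !=set0); last first.
  rewrite (_ : A = set0)//; apply/seteqP; split => // x Ax.
  by exfalso; apply: A0; exists x.
apply: (@sub_finite_set _ _ [set x]); last exact: finite_set1.
by move=> y Ay; exact: A1.
Qed.

(** The exceptions are a lacuna leaving the cell on the right ([P1]) or on the left ([P2]) and
    filled intervals of level below [n] ([P3]). There is at most one lacuna on each side: of two
    that start at the same point, the shorter would end at a point of [F] inside the longer. *)
Lemma boundary_finite t n : exists l : seq J, forall j,
  cell t n (endpoint j) -> ~ inner_part t n j -> j \in l.
Proof.
have [A0 [B0 [E AB]]] := word_ends_lt X_limit t n.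
have [_ FA FB _ _] := word_ends_cell X_limit E.
have cE := word_ends_itv X_limit E AB.
pose P1 : set J := [set j | [/\ kind j = None, endpoint j = B0 & B0 < endpoint (flip j)]].
pose P2 : set J := [set j | [/\ kind j = None, endpoint j = A0 & endpoint (flip j) < A0]].
pose P3 m : set J := (@interval_code R X) @^-1`
  [set c | c.1.1 = Some m /\ exists t, word_ends t m c.1.2 c.2].
have gapj j : kind j = None -> gap X (endpoint j) (endpoint (flip j)).
  by have := interval_code_valid X_limit j; rewrite /valid_code/=; case: (kind j).
have fP1 : finite_set P1.
  apply: subset1_finite_set => i j [ki ui vi] [kj uj vj].
  apply: (interval_code_inj X_limit); rewrite /interval_code ki kj ui uj; congr (_, _, _).
  have [_ _ Fi hi] := gapj _ ki; have [_ _ Fj hj] := gapj _ kj.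
  rewrite ui in hi; rewrite uj in hj; apply/eqP; rewrite eq_le; apply/andP.
  split; rewrite leNgt; apply/negP => h.
    by apply: (hi _ _ Fj); apply/between_lt => //; rewrite vj.
  by apply: (hj _ _ Fi); apply/between_lt => //; rewrite vi.
have fP2 : finite_set P2.
  apply: subset1_finite_set => i j [ki ui vi] [kj uj vj].
  apply: (interval_code_inj X_limit); rewrite /interval_code ki kj ui uj; congr (_, _, _).
  have [_ _ Fi hi] := gap_sym (gapj _ ki); have [_ _ Fj hj] := gap_sym (gapj _ kj).
  rewrite ui in hi Fi; rewrite uj in hj Fj.
  have [_ Fi' _ _] := gap_sym (gapj _ ki); have [_ Fj' _ _] := gap_sym (gapj _ kj).
  apply/eqP; rewrite eq_le; apply/andP.
  split; rewrite leNgt; apply/negP => h.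
    by apply: (hj _ _ Fi'); apply/between_lt => //; rewrite vi h.
  by apply: (hi _ _ Fj'); apply/between_lt => //; rewrite vj h.
have fP3 m : finite_set (P3 m).
  apply: finite_preimage; last exact: word_codes_finite.
  by move=> i j _ _; exact: (interval_code_inj X_limit).
pose D := P1 `|` P2 `|` \bigcup_(m in `I_n) P3 m.
have /finite_seqP[l lE] : finite_set D.
  rewrite !finite_setU; split; first by split.
  exact: bigcup_finite.
exists l => j cj nj; suff : D j by rewrite lE.
case K : (kind j) => [m|].
  right; have [nm|mn] := leqP n m; last first.
    exists m => //; split => //=.
    by have := interval_code_valid X_limit j; rewrite /valid_code/= K.
  exfalso; apply: nj; have := interval_code_valid X_limit j; rewrite /valid_code/= K.
  move=> [r Er]; have [_ _ _ cru crv] := word_ends_cell X_limit Er.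
  have tr := cell_disjoint X_limit cj (cell_sub X_limit nm cru).
  split => //=; last by move=> m'; rewrite K => -[<-].
  by rewrite (cell_eq tr); exact: (cell_sub X_limit nm).
left; have ncv : ~ cell t n (endpoint (flip j)).
  by move=> cv; apply: nj; split => //= m; rewrite K.
(* A lacuna cannot pass over [A0] or [B0], as both belong to [F]. If it leaves the cell, its
   endpoint in the cell is one of them. *)
have [uv _ _ h] := gapj _ K.
move: ncv cj; rewrite cE /= !in_itv/= => ncv /andP[Au uB].
have [vA|Av] := ltP (endpoint (flip j)) A0.
  right; split => //; apply/eqP; rewrite eq_le Au andbT leNgt; apply/negP => Au'.
  have [_ _ _ h'] := gap_sym (gapj _ K).
  by apply: (h' _ _ FA); apply/between_lt; rewrite ?vA// (lt_trans vA).
have [vB|Bv] := leP (endpoint (flip j)) B0; first by exfalso; apply: ncv; rewrite Av.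
left; split => //; apply/eqP; rewrite eq_le uB/= leNgt; apply/negP => uB'.
by apply: (h _ _ FB); apply/between_lt; rewrite ?Bv ?andbT// (lt_trans uB').
Qed.

End Symmetries.

(** * Riemann sums *)

Section RiemannSums.
Variables (R : realType) (X : similarity_system R).
Hypothesis X_limit : limit_fractal X.
Local Notation a := (left_end X).
Local Notation b := (right_end X).
Local Notation p := (arity X).
Local Notation F := (fractal X).
Implicit Types (s t : address X) (n k m : nat) (x y z u v : R).

Definition finite_address n : finType := {dffun forall i : 'I_n, 'I_(p i)}.

Definition extend n (sigma : finite_address n) : address X :=
  sval (cid (multi_index_address X_limit sigma)).

Lemma extendE n (sigma : finite_address n) (i : 'I_n) : sigma i = extend sigma i.
Proof. exact: (svalP (cid (multi_index_address X_limit sigma))). Qed.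

Definition fcell n (sigma : finite_address n) : set R := cell (extend sigma) n.

Definition fratio n (sigma : finite_address n) : R := wratio (extend sigma) 0 n.

(** The sample points of the Riemann sums; they belong to [F] because [a] belongs to every tail
    fractal. *)
Definition fpoint n (sigma : finite_address n) : R := word (extend sigma) 0 n a.

Lemma fratio_gt0 n (sigma : finite_address n) : 0 < fratio sigma.
Proof. exact: wratio_gt0. Qed.

Lemma fpoint_fractal n (sigma : finite_address n) : F (fpoint sigma).
Proof. by have [] := cell_ends X_limit (extend sigma) n. Qed.

Lemma fpoint_fcell n (sigma : finite_address n) : fcell sigma (fpoint sigma).
Proof. by have [] := cell_ends X_limit (extend sigma) n. Qed.

Lemma fractal_fcell n x : F x -> exists sigma : finite_address n, fcell sigma x.
Proof.
move=> /(fractal_cell X_limit n)[t ct]; pose sigma : finite_address n := [ffun i : 'I_n => t i].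
exists sigma; rewrite /fcell (@cell_eq _ _ _ t)// => m mn.
by rewrite -(extendE sigma (Ordinal mn)) ffunE.
Qed.

Lemma fcell_inj n (sigma sigma' : finite_address n) x :
  fcell sigma x -> fcell sigma' x -> sigma = sigma'.
Proof.
move=> c c'; apply/ffunP => i; rewrite !extendE.
exact: (cell_disjoint X_limit c c').
Qed.

Definition step n (c : finite_address n -> R) x : R :=
  \sum_(sigma : finite_address n) c sigma * \1_(fcell sigma) x.

Lemma stepE n (c : finite_address n -> R) (sigma : finite_address n) x :
  fcell sigma x -> step c x = c sigma.
Proof.
move=> cx; rewrite /step (bigD1 sigma)//= indicE mem_set// mulr1 big1 ?addr0//.
move=> sigma' ne; rewrite indicE memNset ?mulr0// => cx'.
by rewrite (fcell_inj cx' cx) eqxx in ne.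
Qed.

Section Mass.
Variable s : R.

Definition mass n (sigma : finite_address n) : R :=
  fratio sigma `^ s / \sum_(sigma' : finite_address n) fratio sigma' `^ s.

(** Homogeneity makes [q] proportional to [fratio] to the power [s], and the total 1 fixes the
    factor. This identifies the cell masses of the trace and of the measure alike. *)
Lemma mass_unique n (q : finite_address n -> R) :
  (forall sigma sigma', q sigma' = (fratio sigma' / fratio sigma) `^ s * q sigma) ->
  \sum_(sigma : finite_address n) q sigma = 1 ->
  forall sigma, q sigma = mass sigma.
Proof.
move=> hq q1 sigma; rewrite /mass.
have l0 (sigma' : finite_address n) : 0 < fratio sigma' `^ s by rewrite powR_gt0 ?fratio_gt0.
have E sigma' : q sigma' = fratio sigma' `^ s * (q sigma / fratio sigma `^ s).
  rewrite (hq sigma) powRM ?invr_ge0 ?ltW ?fratio_gt0//.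
  rewrite -powR_inv1 ?ltW ?fratio_gt0// -powRrM mulN1r powRN.
  by rewrite -mulrA (mulrC _ (q sigma)).
move: q1; under eq_bigr do rewrite E.
rewrite -mulr_suml; set S := \sum_(_ | _) _ => S1.
have S0 : S != 0 by apply/eqP => S0; move: S1; rewrite S0 mul0r => /eqP; rewrite eq_sym oner_eq0.
rewrite E -/S; congr (_ * _).
by apply: (mulfI S0); rewrite S1 divff.
Qed.

Definition riemann_sum (f : R -> R) n : R :=
  \sum_(sigma : finite_address n) f (fpoint sigma) * mass sigma.

End Mass.

(** Uniform continuity in terms of cells: the estimate holds near each point of [F] from some level
    on, and compactness makes the level uniform. *)
Lemma fcell_oscillation (f : R -> R) (e : R) : {within F, continuous f} -> 0 < e ->
  \forall n \near \oo, forall (sigma : finite_address n) x,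
    F x -> fcell sigma x -> `|f x - f (fpoint sigma)| <= e.
Proof.
move=> cf e0.
have /compact_near_coveringP/(_ _ \oo (fun n x =>
    forall sigma : finite_address n, F x -> fcell sigma x ->
    `|f x - f (fpoint sigma)| <= e)) := fractal_compact X_limit.
case=> [x Fx|N _ hN]; last first.
  by exists N => // n Nn sigma x Fx; exact: hN.
have /subspace_continuousP/(_ _ Fx)/cvgrPdist_lt/(_ _ (divr_gt0 e0 (ltr0Sn _ 1))) := cf.
move=> /nbhs_ballP[d /= d0 hd].
have [N hN] := cells_shrink X_limit (divr_gt0 d0 (ltr0Sn _ 1)).
(* Half of [d] is spent on the distance from [x] to [x'], the other half on the length of the
   cell. *)
exists (ball x (d / 2), [set n | (N <= n)%N]).
  by split => /=; [exact: nbhsx_ballx (divr_gt0 d0 _)|exists N].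
move=> [x' n] [/= xx' Nn] sigma Fx' cx'.
have cd := cell_diam X_limit cx' (fpoint_fcell sigma).
have lt2 := le_lt_trans cd (hN n Nn (extend sigma)).
have h1 : `|f x - f x'| < e / 2.
  by apply: hd => //=; apply: le_ball xx'; lra.
have h2 : `|f x - f (fpoint sigma)| < e / 2.
  apply: hd; last exact: fpoint_fractal.
  rewrite /ball/= (_ : x - _ = (x - x') + (x' - fpoint sigma)); last by rewrite addrA subrK.
  rewrite (le_lt_trans (ler_normD _ _))//; rewrite /ball/= in xx'; lra.
rewrite (_ : f x' - _ = (f x - f (fpoint sigma)) - (f x - f x')); last by ring.
rewrite (le_trans (ler_normB _ _))//; lra.
Qed.

End RiemannSums.

(** * The functional defined by a singular trace *)

Section TraceSide.
Variables (R : realType) (X : similarity_system R).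
Hypothesis X_limit : limit_fractal X.
Local Notation a := (left_end X).
Local Notation b := (right_end X).
Local Notation F := (fractal X).
Local Notation J := (triple_basis X).
Local Notation H := (ell2 R J).
Variables (s : R) (s_gt0 : 0 < s).
Implicit Types (n k m : nat) (x y z u v : R) (j : J) (g h : R -> R).

Let ab : a < b := ends_lt X_limit.

Definition ell j : R := interval_length (interval_of j.1) `^ s.

Let L : R := (b - a) `^ s.

Lemma ell_bounds : nneg_bounded L ell.
Proof.
move=> j; rewrite /ell (interval_lengthE X_limit) powR_ge0/=.
apply: ge0_ler_powR; rewrite ?nnegrE ?subr_ge0 ?(ltW s_gt0) ?(ltW ab)//.
have /andP[au ub] := tail_fractal_itv X_limit (endpoint_fractal X_limit j).
have /andP[av vb] := tail_fractal_itv X_limit (endpoint_fractal X_limit (flip j)).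
rewrite ler_norml; lra.
Qed.

Lemma interval_length_gt0 j : 0 < interval_length (interval_of j.1).
Proof.
rewrite (interval_lengthE X_limit) normr_gt0 subr_eq0.
exact: (valid_code_neq X_limit (interval_code_valid X_limit j)).
Qed.

Lemma flipK : involutive (@flip R X).
Proof. by case=> k e; rewrite /flip /= negbK. Qed.

Lemma flip_neq j : flip j == j = false.
Proof. by case: j => k [] /=; apply/eqP => -[]. Qed.

(** On the block of an interval of length [len], the sum and the difference of the two basis vectors
    are eigenvectors of D with eigenvalues [1 / len] and [- 1 / len]. The function is even, so [T]
    acts there as the scalar [len] to the power [s]. *)
Lemma functional_calculus_dirac (T : H -> H) :
  functional_calculus (dirac_operator X) (fun l => `|l| `^ (- s)) T ->
  T = real_mul ell.
Proof.
move=> [bT eT].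
have [bE _] := positive_real_mul ell_bounds.
apply: (bounded_operator_ext bT bE) => i.
pose e1 := basis_vector R i; pose e2 := basis_vector R (flip i).
pose len := interval_length (interval_of i.1).
have len0 : 0 < len := interval_length_gt0 i.
have eig (c : R) : c = 1 \/ c = -1 ->
    T (e1 + c%:C%C *: e2) = (ell i)%:C%C *: (e1 + c%:C%C *: e2).
  move=> c1; rewrite (eT (c / len)).
    congr (_%:C%C *: _); rewrite normrM normfV (gtr0_norm len0).
    have -> : `|c| = 1 by case: c1 => ->; rewrite ?normrN normr1.
    by rewrite mul1r -powR_inv1 ?(ltW len0)// -powRrM mulN1r opprK.
  move=> j; rewrite /dirac_operator !ell2_addE !ell2_scaleE /=.
  rewrite -/(flip j).
  have fj j' : (flip j == j') = (j == flip j').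
    by rewrite -(inj_eq (can_inj flipK)) flipK.
  rewrite !fj flipK.
  have [->|ji] := eqVneq j i.
    rewrite -/len (eq_sym i) flip_neq !(mulr0, mulr1, addr0, add0r).
    by rewrite -!rmorphM/= mulrC; case: c1 => ->.
  have [->|jf] := eqVneq j (flip i); last by rewrite !(mulr0, addr0).
  rewrite /flip/= -/len !(mulr0, mulr1, addr0, add0r) -!rmorphM/=.
  by congr (_%:C%C); rewrite mulrAC; case: c1 => ->; rewrite ?mulrNN mulr1 mul1r.
have h1 := eig 1 (or_introl erefl); have h2 := eig (-1) (or_intror erefl).
have two : (2 : R[i]) != 0 by rewrite pnatr_eq0.
have e1E : e1 = 2^-1 *: (e1 + 1%:C%C *: e2) + 2^-1 *: (e1 + (-1)%:C%C *: e2).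
  rewrite -scalerDr addrACA -scalerDl -rmorphD/= subrr scale0r addr0.
  by rewrite -mulr2n -[e1 *+ 2]scaler_nat scalerA mulVf// scale1r.
rewrite -/e1.
have -> : T e1 = (ell i)%:C%C *: e1.
  rewrite {1}e1E bT.1 h1 -[2^-1 *: (e1 + (-1)%:C%C *: e2)]addr0 bT.1 h2.
  rewrite (ell2_linear0 bT.1).
  by rewrite addr0 !scalerA mulrC -!scalerA -scalerDr -e1E.
apply: ell2_eqP => j; rewrite (real_mulE ell_bounds) ell2_scaleE /=.
by case: (eqVneq j i) => [->|_]; [reflexivity|rewrite !mulr0].
Qed.

Variable tau : (H -> H) -> \bar R.
Hypothesis tau_singular : singular_trace tau.
Hypothesis tau_normalized : tau (abs_pow (dirac_operator X) s) = 1%E.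

Let tau_weight : tracial_weight tau := tau_singular.1.

(** If no operator met the specification, [abs_pow] would be its default 0, whose trace is 0,
    against the normalization. *)
Lemma abs_powE : abs_pow (dirac_operator X) s = real_mul ell.
Proof.
have [ex|nex] := pselect (exists T : H -> H,
  functional_calculus (dirac_operator X) (fun l => `|l| `^ (- s)) T).
  by apply: functional_calculus_dirac; exact: (xgetPex _ ex).
exfalso; have := tau_normalized; rewrite /abs_pow xgetPN; last first.
  by move=> T hT; apply: nex; exists T.
have z : nneg_bounded 0 (fun _ : J => 0 : R) by move=> j; rewrite lexx.
have -> : (fun=> 0) = real_mul (fun _ : J => 0 : R).
  by apply/funext => x; apply: ell2_eqP => j; rewrite (real_mulE z) mul0r.
rewrite (singular_trace_finite_support (s := [::]) tau_singular z)// => /eqP.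
by rewrite eq_sym onee_eq0.
Qed.

Lemma tau_ell : tau (real_mul ell) = 1%E.
Proof. by rewrite -abs_powE. Qed.

Definition on_endpoints g j : R := g (endpoint j) * ell j.

(** Bounds on [F] are what the diagonal operators see, since all endpoints lie in [F]. *)
Definition fractal_bounded (c : R) g := forall x, F x -> 0 <= g x <= c.

Lemma on_endpoints_bounded (c : R) g : fractal_bounded c g ->
  nneg_bounded (c * L) (on_endpoints g).
Proof.
move=> gc j; have /andP[g0 gc'] := gc _ (endpoint_fractal X_limit j).
have /andP[l0 lL] := ell_bounds j.
by rewrite mulr_ge0//= ler_pM.
Qed.

(** The functional sending [g] to the trace of [g |D|^-s]; for [g] nonnegative and bounded on [F],
    [fine] loses nothing, by [tau_on_endpoints]. *)
Definition nu g : R := fine (tau (real_mul (on_endpoints g))).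

Lemma tau_on_endpoints (c : R) g : fractal_bounded c g ->
  tau (real_mul (on_endpoints g)) = (nu g)%:E.
Proof.
move=> gc; have gb := on_endpoints_bounded gc.
have [Fa _] := tail_fractal_ends X_limit 0.
have c0 : 0 <= c by have /andP[/le_trans] := gc _ Fa; apply.
rewrite /nu fineK// ge0_fin_numE ?(weight_real_mul_ge0 tau_weight gb)//.
have cb : nneg_bounded (c * L) (fun j => c * ell j).
  by move=> j; have /andP[? ?] := ell_bounds j; rewrite mulr_ge0//= ler_wpM2l.
apply: (@le_lt_trans _ _ (tau (real_mul (fun j => c * ell j)))).
  apply: (le_weight_real_mul tau_weight gb cb) => j.
  have /andP[_ gj] := gc _ (endpoint_fractal X_limit j).
  by rewrite ler_wpM2r//; have /andP[] := ell_bounds j.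
by rewrite (weight_real_mulZ tau_weight c0 ell_bounds) tau_ell mule1 ltry.
Qed.

Lemma nu_le (c d : R) g h : fractal_bounded c g -> fractal_bounded d h ->
  (forall x, F x -> g x <= h x) -> nu g <= nu h.
Proof.
move=> gc hd gh; rewrite -lee_fin -(tau_on_endpoints gc) -(tau_on_endpoints hd).
have hb := on_endpoints_bounded hd.
have ghj j : on_endpoints g j <= on_endpoints h j.
  rewrite ler_wpM2r ?gh//; last exact: endpoint_fractal.
  by have /andP[] := ell_bounds j.
apply: (le_weight_real_mul tau_weight (k := d * L)) => //.
move=> j; have /andP[-> _] := on_endpoints_bounded gc j.
by rewrite (le_trans (ghj j))//; have /andP[] := hb j.
Qed.

Lemma nuD (c d : R) g h : fractal_bounded c g -> fractal_bounded d h ->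
  nu (fun x => g x + h x) = nu g + nu h.
Proof.
move=> gc hd; apply: EFin_inj.
have ghcd : fractal_bounded (c + d) (fun x => g x + h x).
  move=> x Fx; have /andP[? ?] := gc x Fx; have /andP[? ?] := hd x Fx.
  by rewrite addr_ge0//= lerD.
rewrite EFinD -(tau_on_endpoints gc) -(tau_on_endpoints hd) -(tau_on_endpoints ghcd).
have lift (e f : R) (g' : J -> R) : e <= f -> nneg_bounded e g' -> nneg_bounded f g'.
  by move=> ef g'e j; have /andP[-> /= /le_trans] := g'e j; apply.
rewrite -(weight_real_mulD tau_weight (k := Num.max (c * L) (d * L))).
- by congr (tau (real_mul _)); apply/funext => j; rewrite /on_endpoints mulrDl.
- by apply: lift (on_endpoints_bounded gc); rewrite le_max lexx.
- by apply: lift (on_endpoints_bounded hd); rewrite le_max lexx orbT.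
Qed.

Lemma nuZ (c d : R) g : 0 <= d -> fractal_bounded c g ->
  nu (fun x => d * g x) = d * nu g.
Proof.
move=> d0 gc; apply: EFin_inj.
have gcd : fractal_bounded (d * c) (fun x => d * g x).
  by move=> x Fx; have /andP[? ?] := gc x Fx; rewrite mulr_ge0//= ler_wpM2l.
rewrite EFinM -(tau_on_endpoints gc) -(tau_on_endpoints gcd).
rewrite -(weight_real_mulZ tau_weight d0 (on_endpoints_bounded gc)).
by congr (tau (real_mul _)); apply/funext => j; rewrite /on_endpoints mulrA.
Qed.

Lemma nu_cst (c : R) : 0 <= c -> nu (fun=> c) = c.
Proof.
move=> c0; rewrite /nu (_ : on_endpoints _ = fun j => c * ell j)//.
by rewrite (weight_real_mulZ tau_weight c0 ell_bounds) tau_ell mule1.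
Qed.

Lemma nu_sum (I : Type) (r : seq I) (c : R) (G : I -> R -> R) :
  (forall i, fractal_bounded c (G i)) ->
  nu (fun x => \sum_(i <- r) G i x) = \sum_(i <- r) nu (G i) /\
  fractal_bounded (\sum_(i <- r) c) (fun x => \sum_(i <- r) G i x).
Proof.
move=> Gc; elim: r => [|i r [IH1 IH2]].
  have -> : (fun x => \sum_(i <- [::]) G i x) = (fun=> 0).
    by apply/funext => x; rewrite big_nil.
  by rewrite !big_nil nu_cst//; split => // x _; rewrite lexx.
have -> : (fun x => \sum_(i <- i :: r) G i x) =
    (fun x => G i x + \sum_(i <- r) G i x).
  by apply/funext => x; rewrite big_cons.
rewrite !big_cons (nuD (Gc i) IH2) IH1; split => // x Fx.
by have /andP[? ?] := Gc i x Fx; have /andP[? ?] := IH2 x Fx; rewrite addr_ge0//= lerD.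
Qed.

Definition inner_ell (t : address X) n j : R := (j \in inner_part t n)%:R * ell j.

Lemma inner_ell_bounded t n : nneg_bounded L (inner_ell t n).
Proof.
move=> j; have /andP[l0 lL] := ell_bounds j; rewrite /inner_ell.
by case: (_ \in _); rewrite ?mul1r ?mul0r ?l0// lexx (le_trans l0).
Qed.

Lemma indic_bounded (A : set R) : fractal_bounded 1 (\1_A).
Proof. by move=> x _; rewrite indicE; case: (_ \in _); rewrite ?lexx ?ler01. Qed.

(** The remainder [rest] gathers the endpoints in the cell whose interval is not an inner one. It
    has finite support by [boundary_finite]. *)
Lemma nu_cell (t : address X) n :
  (nu (\1_(cell t n)))%:E = tau (real_mul (inner_ell t n)).
Proof.
rewrite -(tau_on_endpoints (indic_bounded _)).
have [l hl] := boundary_finite X_limit t n.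
pose rest j : R := (endpoint j \in cell t n)%:R * (j \notin inner_part t n)%:R * ell j.
have restb : nneg_bounded L rest.
  move=> j; have /andP[l0 lL] := ell_bounds j; rewrite /rest.
  by case: (_ \in cell _ _); case: (_ \in inner_part _ _);
    rewrite /= ?(mulr1, mul1r, mulr0, mul0r) ?l0// lexx (le_trans l0).
have -> : on_endpoints (\1_(cell t n)) = fun j => inner_ell t n j + rest j.
  apply/funext => j; rewrite /on_endpoints /inner_ell /rest indicE -mulrDl.
  congr (_ * _); have [ij|ij] := boolP (j \in inner_part t n).
    by move: ij => /set_mem[cj _ _]; rewrite mem_set// mulr0 addr0.
  by rewrite mulr1 add0r.
rewrite (weight_real_mulD tau_weight (inner_ell_bounded t n) restb).
rewrite (singular_trace_finite_support (s := l) tau_singular restb) ?adde0//.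
move=> j jl; rewrite /rest; case: (boolP (endpoint j \in cell t n)) => [|_]; last first.
  by rewrite !mul0r.
move=> /set_mem cj; case: (boolP (j \in inner_part t n)) => [_|nj]; first by rewrite mulr0 mul0r.
by exfalso; move/negP : jl; apply; apply: hl => // ij; rewrite mem_set in nj.
Qed.

Lemma nu_fcell_homogeneous n (sigma sigma' : finite_address X n) :
  nu (\1_(fcell X_limit sigma')) =
  (fratio X_limit sigma' / fratio X_limit sigma) `^ s * nu (\1_(fcell X_limit sigma)).
Proof.
(* The swap requires disjoint cells, hence distinct words. *)
have [<-|ne] := eqVneq sigma sigma'.
  by rewrite divff ?gt_eqF ?fratio_gt0// powR1 mul1r.
have disj x : cell (extend X_limit sigma) n x -> ~ cell (extend X_limit sigma') n x.
  by move=> c c'; move/eqP : ne; apply; exact: (fcell_inj c c').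
have [phi [phiK phi_inner phi_code]] := swap_exists X_limit disj.
apply: EFin_inj; rewrite EFinM /fcell !nu_cell.
rewrite (weight_real_mul_involutive tau_weight (inner_ell_bounded _ _) phiK).
set c : R := _ `^ s; have c0 : 0 <= c by exact: powR_ge0.
rewrite -(weight_real_mulZ tau_weight c0 (inner_ell_bounded _ _)).
congr (tau (real_mul _)); apply/funext => j; rewrite /inner_ell /=.
have [ij|ij] := pselect (inner_part (extend X_limit sigma) n j); last first.
  by rewrite !memNset ?mul0r ?mulr0// => /phi_inner.
rewrite !mem_set ?mul1r//; last exact/phi_inner.
have [_ E1 E2] := phi_code j ij.
rewrite /ell !(interval_lengthE X_limit) E1 E2 symmetry_dist//.
by rewrite powRM// divr_ge0 ?ltW ?wratio_gt0.
Qed.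

Lemma nu_fcell n (sigma : finite_address X n) :
  nu (\1_(fcell X_limit sigma)) = mass X_limit s sigma.
Proof.
apply: (@mass_unique _ _ X_limit s n (fun sigma => nu (\1_(fcell X_limit sigma)))).
  by move=> *; exact: nu_fcell_homogeneous.
have [<- _] := nu_sum (index_enum (finite_address X n))
  (fun sigma => indic_bounded (fcell X_limit sigma)).
(* At every endpoint, being a point of [F], the indicators of the cells of level [n] add up to 1. *)
rewrite -[RHS](nu_cst ler01); congr fine; congr (tau (real_mul _)).
apply/funext => j; rewrite /on_endpoints; congr (_ * _).
have [sigma0 c0] := fractal_fcell X_limit n (endpoint_fractal X_limit j).
have := stepE (fun=> 1) c0; rewrite /step => <-.
by apply: eq_bigr => i _; rewrite mul1r.
Qed.

Lemma nu_step n (c : finite_address X n -> R) : (forall sigma, 0 <= c sigma) ->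
  nu (step X_limit c) = \sum_(sigma : finite_address X n) c sigma * mass X_limit s sigma /\
  exists d, fractal_bounded d (step X_limit c).
Proof.
move=> c0; pose M := \sum_sigma c sigma.
have cb sigma : fractal_bounded M (fun x => c sigma * \1_(fcell X_limit sigma) x).
  move=> x Fx; have /andP[i0 i1] := indic_bounded (fcell X_limit sigma) Fx.
  rewrite mulr_ge0//= (@le_trans _ _ (c sigma))//; first by rewrite ler_piMr.
  by rewrite /M (bigD1 sigma)//= lerDl sumr_ge0.
have [E B] := nu_sum (index_enum (finite_address X n)) cb.
split; last by exists (\sum_(i <- index_enum (finite_address X n)) M).
rewrite /step E; apply: eq_bigr => sigma _.
by rewrite (nuZ (c0 sigma) (indic_bounded _)) nu_fcell.
Qed.

(** [nu] is compared on nonnegative functions, so the estimate on [g - S] is used as the two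
    inequalities [g <= S + e] and [S <= g + e]. *)
Lemma riemann_sum_nu (c : R) (g : R -> R) : {within F, continuous g} ->
  fractal_bounded c g -> riemann_sum X_limit s g n @[n --> \oo] --> nu g.
Proof.
move=> gcont gc; apply/cvgrPdist_le => e e0.
apply: filterS (fcell_oscillation X_limit gcont e0) => n osc.
pose S := step X_limit (fun sigma : finite_address X n => g (fpoint X_limit sigma)).
have gp sigma : 0 <= g (fpoint X_limit (sigma : finite_address X n)).
  by have /andP[] := gc _ (fpoint_fractal X_limit sigma).
have [SE [d Sd]] := nu_step gp; rewrite -/S in SE Sd.
rewrite /riemann_sum -SE.
have eb : fractal_bounded e (fun=> e) by move=> x _; rewrite (ltW e0) lexx.
have Dbnd (c' : R) h : fractal_bounded c' h -> fractal_bounded (c' + e) (fun x => h x + e).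
  by move=> hc x Fx; have /andP[? ?] := hc x Fx; rewrite addr_ge0 ?(ltW e0)//= lerD2r.
have near x : F x -> `|g x - S x| <= e.
  move=> Fx; have [sigma cx] := fractal_fcell X_limit n Fx.
  by rewrite /S (stepE _ cx); exact: osc.
have h1 : nu g <= nu S + e.
  rewrite -[X in _ + X](nu_cst (ltW e0)) -(nuD Sd eb); apply: (nu_le gc (Dbnd _ _ Sd)) => x Fx.
  by have := near x Fx; rewrite ler_norml; lra.
have h2 : nu S <= nu g + e.
  rewrite -[X in _ + X](nu_cst (ltW e0)) -(nuD gc eb); apply: (nu_le Sd (Dbnd _ _ gc)) => x Fx.
  by have := near x Fx; rewrite ler_norml; lra.
by rewrite ler_norml; lra.
Qed.

End TraceSide.

(** * Integration against the homogeneous measure *)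

Section MeasureSide.
Variables (R : realType) (X : similarity_system R).
Hypothesis X_limit : limit_fractal X.
Local Notation a := (left_end X).
Local Notation b := (right_end X).
Local Notation F := (fractal X).
Variables (s : R) (mu : probability (measurableTypeR R) R).
Hypothesis mu_fractal : mu F = 1%E.
Hypothesis mu_homogeneous : homogeneous X s mu.
Implicit Types (n k m : nat) (x y z u v : R) (g h : R -> R).

Lemma measurable_fractal : measurable (F : set (measurableTypeR R)).
Proof. exact: closed_measurable (fractal_closed X_limit). Qed.

Lemma measurable_fcell n (sigma : finite_address X n) :
  measurable (fcell X_limit sigma : set (measurableTypeR R)).
Proof.
have [u [v [E uv]]] := word_ends_lt X_limit (extend X_limit sigma) n.
by rewrite /fcell (word_ends_itv X_limit E uv); exact: measurable_itv.
Qed.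

Definition weight n (sigma : finite_address X n) : R :=
  fine (mu (fcell X_limit sigma `&` F)).

Lemma weightE n (sigma : finite_address X n) :
  mu (fcell X_limit sigma `&` F) = (weight sigma)%:E.
Proof.
rewrite /weight fineK//; apply: fin_num_measure.
by apply: measurableI; [exact: measurable_fcell|exact: measurable_fractal].
Qed.

Definition integral_F g : \bar R := (\int[mu]_(x in F) (g x)%:E)%E.

Lemma measurable_step n (c : finite_address X n -> R) :
  measurable_fun (F : set (measurableTypeR R)) (fun x => (step X_limit c x)%:E).
Proof.
apply/measurable_EFinP; apply: measurable_sum => sigma.
apply: measurable_funM => //; apply: measurable_indic.
exact: measurable_fcell.
Qed.

Lemma integral_step n (c : finite_address X n -> R) : (forall sigma, 0 <= c sigma) ->
  integral_F (step X_limit c) =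
  (\sum_(sigma : finite_address X n) c sigma * weight sigma)%:E.
Proof.
move=> c0; rewrite /integral_F /step; have mF := measurable_fractal.
have mi (sigma : finite_address X n) : measurable_fun (F : set (measurableTypeR R))
    (fun x => (\1_(fcell X_limit sigma) x : R)%:E).
  apply/measurable_EFinP; apply: measurable_indic.
  exact: measurable_fcell.
under eq_integral do rewrite -sumEFin.
rewrite ge0_integral_sum; last 3 first.
- exact: measurable_fractal.
- move=> sigma; under eq_fun do rewrite EFinM.
  exact: measurable_funeM.
- by move=> sigma x _; rewrite lee_fin mulr_ge0// indicE ler0n.
rewrite -sumEFin; apply: eq_bigr => sigma _.
under eq_integral do rewrite EFinM.
have i0 x : F x -> (0 <= (\1_(fcell X_limit sigma) x : R)%:E)%E.
  by move=> _; rewrite lee_fin indicE ler0n.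
rewrite (ge0_integralZl_EFin _ mF i0 (mi sigma) (c0 sigma)).
by rewrite (integral_indic _ mF (measurable_fcell sigma)) EFinM -weightE.
Qed.

Lemma weight_homogeneous n (sigma sigma' : finite_address X n) : (0 < n)%N ->
  weight sigma' =
  (fratio X_limit sigma' / fratio X_limit sigma) `^ s * weight sigma.
Proof.
move=> n0; apply: EFin_inj; rewrite EFinM -!weightE.
have wE (r : finite_address X n) : wword r = word (extend X_limit r) 0 n.
  by apply: wword_word => i; exact: extendE.
have lE (r : finite_address X n) : lambdaword r = fratio X_limit r.
  by apply: lambdaword_wratio => i; exact: extendE.
have cE (r : finite_address X n) : fcell X_limit r `&` F = cylinder r.
  rewrite /cylinder wE; apply/seteqP; split=> x.
    by move=> /(cell_tail X_limit)[y Fy ->]; exists y.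
  by move=> [y Fy <-]; apply/(cell_tail X_limit); exists y.
pose T := symmetry (extend X_limit sigma) (extend X_limit sigma') n.
have TG : generating_symmetry sigma sigma' T.
  by move=> x _; rewrite !wE; exact: symmetry_word.
(* With the whole line as open set, homogeneity compares the full cylinders. *)
have := mu_homogeneous n0 TG openT; rewrite !setTI !lE -!cE => <-.
congr (mu _); rewrite !cE /cylinder !wE; apply/seteqP; split=> x.
  by move=> [y Fy <-]; exists (word (extend X_limit sigma) 0 n y);
    [exists y|exact: symmetry_word].
by move=> [_ [y Fy <-] <-]; exists y => //; rewrite /T symmetry_word.
Qed.

Lemma weight_mass n (sigma : finite_address X n) : (0 < n)%N ->
  weight sigma = mass X_limit s sigma.
Proof.
move=> n0; apply: (mass_unique (q := @weight n)).
  by move=> *; exact: weight_homogeneous.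
apply: EFin_inj; under eq_bigr do rewrite -[weight _]mul1r.
(* The total of the weights is the integral over [F] of the step function with all coefficients 1,
   that is, the mass of [F]. *)
rewrite -(@integral_step n (fun=> 1))// -mu_fractal -[RHS]mul1e.
rewrite -integral_cst; last exact: measurable_fractal.
apply: eq_integral => x /set_mem Fx.
have [sigma0 c0] := fractal_fcell X_limit n Fx.
by rewrite (stepE _ c0).
Qed.

Lemma integral_F_cst (c : R) : integral_F (fun=> c) = c%:E.
Proof.
rewrite /integral_F integral_cst; last exact: measurable_fractal.
by rewrite -[RHS]mule1 -mu_fractal.
Qed.

Lemma measurable_continuous g : {within F, continuous g} ->
  measurable_fun (F : set (measurableTypeR R)) (fun x => (g x)%:E).
Proof.
move=> cg; apply/measurable_EFinP.
apply: subspace_continuous_measurable_fun => //; exact: measurable_fractal.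
Qed.

Lemma integral_F_fin (c : R) g : {within F, continuous g} -> fractal_bounded X c g ->
  integral_F g = (fine (integral_F g))%:E.
Proof.
move=> cg gc; rewrite fineK// ge0_fin_numE; last first.
  by apply: integral_ge0 => x Fx; rewrite lee_fin; have /andP[] := gc x Fx.
apply: (@le_lt_trans _ _ c%:E); last exact: ltry.
rewrite -integral_F_cst; apply: ge0_le_integral.
- exact: measurable_fractal.
- by move=> x Fx; rewrite lee_fin; have /andP[] := gc x Fx.
- exact: measurable_continuous.
- exact: measurable_cst.
- by move=> x Fx; rewrite lee_fin; have /andP[] := gc x Fx.
Qed.

Lemma riemann_sum_integral (c : R) g : {within F, continuous g} ->
  fractal_bounded X c g ->
  riemann_sum X_limit s g n @[n --> \oo] --> fine (integral_F g).
Proof.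
move=> gcont gc; apply/cvgrPdist_le => e e0.
have mF := measurable_fractal.
near=> n; pose S := step X_limit (fun sigma : finite_address X n => g (fpoint X_limit sigma)).
(* Homogeneity of the measure is stated for words of length at least 1. *)
have n0 : (0 < n)%N by near: n; exists 1%N.
have g0 x : F x -> 0 <= g x by move=> Fx; have /andP[] := gc x Fx.
have gp sigma : 0 <= g (fpoint X_limit (sigma : finite_address X n)).
  exact/g0/fpoint_fractal.
have SE : integral_F S = (riemann_sum X_limit s g n)%:E.
  rewrite (integral_step gp); congr (_%:E); apply: eq_bigr => sigma _.
  by rewrite weight_mass.
have close x : F x -> `|g x - S x| <= e.
  move=> Fx; have [sigma cx] := fractal_fcell X_limit n Fx.
  rewrite /S (stepE _ cx); move: Fx cx; move: sigma x; near: n.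
  by apply: filterS (fcell_oscillation X_limit gcont e0) => n h sigma x; exact: h.
have S0 x : F x -> 0 <= S x.
  move=> Fx; have [sigma cx] := fractal_fcell X_limit n Fx.
  by rewrite /S (stepE _ cx).
have mg := measurable_continuous gcont.
have mS : measurable_fun (F : set (measurableTypeR R)) (fun x => (S x)%:E).
  exact: measurable_step.
have IE := integral_F_fin gcont gc.
have add_e h : (forall x, F x -> 0 <= h x) ->
    measurable_fun (F : set (measurableTypeR R)) (fun x => (h x)%:E) ->
    (\int[mu]_(x in F) ((h x)%:E + e%:E))%E = (integral_F h + e%:E)%E.
  move=> h0 mh; rewrite ge0_integralD//.
  - by congr (_ + _)%E; exact: integral_F_cst.
  - by move=> x _; rewrite lee_fin ltW.
have h1 : fine (integral_F g) <= riemann_sum X_limit s g n + e.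
  rewrite -lee_fin -IE EFinD -SE -add_e//; apply: ge0_le_integral => //.
  - exact: emeasurable_funD.
  - by move=> x Fx; rewrite -EFinD lee_fin; have := close x Fx; rewrite ler_norml; lra.
have h2 : riemann_sum X_limit s g n <= fine (integral_F g) + e.
  rewrite -lee_fin -SE EFinD -IE -add_e//; apply: ge0_le_integral => //.
  - exact: emeasurable_funD.
  - by move=> x Fx; rewrite -EFinD lee_fin; have := close x Fx; rewrite ler_norml; lra.
by rewrite ler_norml; lra.
Unshelve. all: by end_near.
Qed.

End MeasureSide.

(** * Complex-valued functions *)

Section ComplexParts.
Variables (R : realType) (X : similarity_system R).
Hypothesis X_limit : limit_fractal X.
Local Notation F := (fractal X).
Local Notation C := (R[i]^o).
Local Notation J := (triple_basis X).
Local Notation H := (ell2 R J).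
Variable f : R -> C.
Hypothesis f_cont : {within F, continuous f}.

Lemma ler_Re_normc (z : R[i]) : `|complex.Re z| <= normc z.
Proof.
case: z => u v /=; rewrite -[leLHS]sqrtr_sqr ler_wsqrtr//.
by rewrite lerDl sqr_ge0.
Qed.

Lemma ler_Im_normc (z : R[i]) : `|complex.Im z| <= normc z.
Proof.
case: z => u v /=; rewrite -[leLHS]sqrtr_sqr ler_wsqrtr//.
by rewrite lerDr sqr_ge0.
Qed.

(** The order of the four parts matches the powers of i in [trace_decomposition]. *)
Definition complex_part (k : 'I_4) (z : R[i]) : R :=
  Num.max (nth 0 [:: complex.Re z; complex.Im z; - complex.Re z; - complex.Im z] k) 0.

Lemma complex_part_ge0 k z : 0 <= complex_part k z.
Proof. by rewrite le_max lexx orbT. Qed.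

Lemma complex_partE z : z = \sum_(k < 4) 'i%C ^+ k * (complex_part k z)%:C%C.
Proof.
rewrite !big_ord_recr big_ord0 /= /complex_part /=.
have i2 : 'i%C ^+ 2 = -1 :> R[i] by rewrite sqr_i.
have i3 : 'i%C ^+ 3 = - 'i%C :> R[i] by rewrite exprS sqr_i mulrN1.
rewrite i2 i3 expr0 expr1 {1}(complexE z) add0r.
rewrite -{1}(maxr0_sub (complex.Re z)) -{1}(maxr0_sub (complex.Im z)) !rmorphB/=; ring.
Qed.

Lemma complex_part_lipschitz k (z z' : R[i]) :
  `|complex_part k z - complex_part k z'| <= normc (z - z').
Proof.
have max_lip (x y : R) : `|Num.max x 0 - Num.max y 0| <= `|x - y|.
  have [hx|hx] := lerP x 0; have [hy|hy] := lerP y 0.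
  - by rewrite subrr normr0.
  - by rewrite sub0r normrN gtr0_norm// distrC; apply: le_trans (ler_norm _); lra.
  - by rewrite subr0 gtr0_norm//; apply: le_trans (ler_norm _); lra.
  - by [].
have re : `|complex.Re z - complex.Re z'| <= normc (z - z').
  by have := ler_Re_normc (z - z'); rewrite raddfB.
have im : `|complex.Im z - complex.Im z'| <= normc (z - z').
  by have := ler_Im_normc (z - z'); rewrite raddfB.
apply: (le_trans (max_lip _ _)).
by case: k => -[|[|[|[|//]]]] h //=; rewrite -opprD normrN.
Qed.

Lemma complex_part_continuous k : {within F, continuous (complex_part k \o f)}.
Proof.
apply/subspace_continuousP => x Fx; apply/cvgrPdist_lt => e e0.
have /subspace_continuousP/(_ _ Fx)/cvgrPdist_lt := f_cont.
have ec : (0 : R[i]) < e%:C%C by rewrite ltcR.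
move=> /(_ _ ec); apply: filterS => y; rewrite normc_def ltcR; apply: le_lt_trans.
apply: le_trans (complex_part_lipschitz _ _ _) _.
by case: (f x - f y).
Qed.

(** At a level where [g] varies by at most 1 from the sample value of its cell, the finitely many
    sample values bound [g]; as they are nonnegative, their sum bounds each of them. *)
Lemma continuous_fractal_bounded (g : R -> R) : {within F, continuous g} ->
  (forall x, 0 <= g x) -> exists c, fractal_bounded X c g.
Proof.
move=> gc g0; have [N _ osc] := fcell_oscillation X_limit gc ltr01.
pose c := \sum_(sigma : finite_address X N) g (fpoint X_limit sigma).
exists (c + 1) => x Fx; rewrite g0/=.
have [sigma cx] := fractal_fcell X_limit N Fx.
have := osc N (leqnn N) sigma x Fx cx; rewrite ler_norml => /andP[_ h].
have : g (fpoint X_limit sigma) <= c by rewrite /c (bigD1 sigma)//= lerDl sumr_ge0.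
lra.
Qed.

Section Trace.
Variables (s : R) (s_gt0 : 0 < s) (tau : (H -> H) -> \bar R).
Hypothesis tau_singular : singular_trace tau.
Hypothesis tau_normalized : tau (abs_pow (dirac_operator X) s) = 1%E.

Lemma function_operator_decomposition :
  trace_decomposition tau (function_operator f \o abs_pow (dirac_operator X) s)
    (fun k => real_mul (on_endpoints s (complex_part k \o f))).
Proof.
have bnd k : exists c, fractal_bounded X c (complex_part k \o f).
  apply: continuous_fractal_bounded; first exact: complex_part_continuous.
  by move=> x; exact: complex_part_ge0.
have [c hc] := choice bnd.
rewrite (abs_powE X_limit s_gt0 tau_singular tau_normalized).
split=> [k|x].
  split; first exact: positive_real_mul (on_endpoints_bounded X_limit s_gt0 (hc k)).
  by rewrite (tau_on_endpoints X_limit s_gt0 tau_singular tau_normalized (hc k)) ltry.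
(* A bound on [f] at the endpoints ensures that [multiplication] does not fall back on its default
   0. *)
have fM j : normc (f (endpoint (j : J))) <= \sum_(k < 4) c k.
  rewrite {1}(complex_partE (f (endpoint j))).
  have normc_sum (G : 'I_4 -> R[i]) : normc (\sum_(k < 4) G k) <= \sum_(k < 4) normc (G k).
    elim/big_rec2: _ => [|k u v _ IH]; first by rewrite normc0.
    by apply: le_trans (le_normcD _ _) _; rewrite lerD2l.
  apply: (le_trans (normc_sum _)); apply: ler_sum => k _.
  have normci m : normc ('i%C ^+ m : R[i]) = 1.
    elim: m => [|m IH]; first by rewrite expr0 normc1.
    by rewrite exprS normcM IH mulr1 /= expr0n add0r expr1n sqrtr1.
  rewrite normcM normci mul1r normc_real ger0_norm ?complex_part_ge0//.
  by have /andP[] := hc k _ (endpoint_fractal X_limit j).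
apply: ell2_eqP => j; rewrite /= /function_operator (mulmE fM).
rewrite (real_mulE (ell_bounds X_limit s_gt0)) ell2_sumE.
rewrite {1}(complex_partE (f (endpoint j))) mulr_suml; apply: eq_bigr => k _.
rewrite ell2_scaleE (real_mulE (on_endpoints_bounded X_limit s_gt0 (hc k))).
by rewrite /on_endpoints rmorphM/= !mulrA.
Qed.

Lemma trace_ext_function_operator :
  trace_ext tau (function_operator f \o abs_pow (dirac_operator X) s) =
  \sum_(k < 4) 'i%C ^+ k * (nu s tau (complex_part k \o f))%:C%C.
Proof. exact: trace_extE tau_singular.1 function_operator_decomposition. Qed.

Lemma riemann_sum_complex_part k :
  riemann_sum X_limit s (complex_part k \o f) n @[n --> \oo]
    --> nu s tau (complex_part k \o f).
Proof.
have kc := complex_part_continuous (k := k).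
have [c hc] := continuous_fractal_bounded kc (fun x => complex_part_ge0 k (f x)).
exact: riemann_sum_nu kc hc.
Qed.

End Trace.

Lemma integral_complex_part (s : R) (mu : probability (measurableTypeR R) R) k :
  mu F = 1%E -> homogeneous X s mu ->
  integral_F X mu (complex_part k \o f) = (fine (integral_F X mu (complex_part k \o f)))%:E /\
  riemann_sum X_limit s (complex_part k \o f) n @[n --> \oo]
    --> fine (integral_F X mu (complex_part k \o f)).
Proof.
move=> muF muh; have kc := complex_part_continuous (k := k).
have [c hc] := continuous_fractal_bounded kc (fun x => complex_part_ge0 k (f x)).
by split; [exact: integral_F_fin hc|exact: riemann_sum_integral hc].
Qed.

End ComplexParts.

(** * Comparison of the two limits *)

Theorem theorem4p8 (R : realType) (X : similarity_system R)
    (X_limit : limit_fractal X)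
    (s : R) (s_exponent : singular_traceability_exponent (dirac_operator X) s)
    (tau : (ell2 R (triple_basis X) -> ell2 R (triple_basis X)) -> \bar R)
    (tau_singular : singular_trace tau)
    (tau_normalized : tau (abs_pow (dirac_operator X) s) = 1%E)
    (f : R -> R[i]^o) (f_cont : {within fractal X, continuous f}) :
  [/\ trace_domain tau (function_operator f \o abs_pow (dirac_operator X) s),
      (forall mu : probability (measurableTypeR R) R,
         mu (fractal X) = 1%E -> homogeneous X s mu ->
         trace_ext tau (function_operator f \o abs_pow (dirac_operator X) s) =
         ((\int[mu]_(x in fractal X) complex.Re (f x)) +i*
          (\int[mu]_(x in fractal X) complex.Im (f x)))%C)
    & (forall tau' : (ell2 R (triple_basis X) -> ell2 R (triple_basis X)) -> \bar R,
         singular_trace tau' -> tau' (abs_pow (dirac_operator X) s) = 1%E ->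
         trace_ext tau' (function_operator f \o abs_pow (dirac_operator X) s) =
         trace_ext tau (function_operator f \o abs_pow (dirac_operator X) s))].
Proof.
have s_gt0 : 0 < s by case: s_exponent.
have lim_tau := riemann_sum_complex_part X_limit f_cont s_gt0 tau_singular tau_normalized.
have tauE := trace_ext_function_operator X_limit f_cont s_gt0 tau_singular tau_normalized.
split.
- by exists (fun k => real_mul (on_endpoints s (complex_part k \o f)));
    exact: function_operator_decomposition.
- move=> mu muF muh; rewrite tauE.
  have nuE k : integral_F X mu (complex_part k \o f) = (nu s tau (complex_part k \o f))%:E.
    have [-> lim_mu] := integral_complex_part X_limit f_cont k muF muh.
    by congr (_%:E); exact: (cvg_unique _ lim_mu (lim_tau k)).
  pose n0 : 'I_4 := @Ordinal 4 0 isT; pose n1 : 'I_4 := @Ordinal 4 1 isT.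
  pose n2 : 'I_4 := @Ordinal 4 2 isT; pose n3 : 'I_4 := @Ordinal 4 3 isT.
  have part g (k l : 'I_4) :
      (forall x, complex_part k (f x) = Num.max (g x) 0) ->
      (forall x, complex_part l (f x) = Num.max (- g x) 0) ->
      \int[mu]_(x in fractal X) g x =
      nu s tau (complex_part k \o f) - nu s tau (complex_part l \o f).
    (* The integral of a signed function is by definition the difference of the integrals of its
       positive and negative parts, which are two of the complex parts of [f]. *)
    move=> gk gl; apply: EFin_inj; rewrite EFinB -!nuE /Rintegral integralE.
    rewrite [X in (X - _)%E](_ : _ = integral_F X mu (complex_part k \o f)); last first.
      by apply: eq_integral => x _; rewrite funeposE /= gk EFin_max.
    rewrite [X in (_ - X)%E](_ : _ = integral_F X mu (complex_part l \o f)); last first.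
      by apply: eq_integral => x _; rewrite funenegE /= gl EFin_max.
    by rewrite fineK// !nuE.
  rewrite (part (fun x => complex.Re (f x)) n0 n2)//.
  rewrite (part (fun x => complex.Im (f x)) n1 n3)//.
  rewrite (sum_ipow (V := R[i]^o) (fun k => (nu s tau (complex_part k \o f))%:C%C)).
  by rewrite [RHS]complexE /= !rmorphB/= /GRing.scale/=; ring.
(* The Riemann sums do not involve the trace, so their limits for [tau] and [tau'] coincide. *)
- move=> tau' st' nt'; rewrite tauE (trace_ext_function_operator X_limit f_cont s_gt0 st' nt').
  apply: eq_bigr => k _.
  have lim_tau' := riemann_sum_complex_part X_limit f_cont s_gt0 st' nt'.
  by rewrite (cvg_unique _ (lim_tau' k) (lim_tau k)).
Qed.
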